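(* Let $K$ be a field and let $A$ be a finite-dimensional selfinjective $K$-algebra. Suppose that for some integer $n\ge 1$ there exists a maximal $n$-orthogonal $A$-module. Then every finitely generated $A$-module $M$ has complexity at most $1$, i.e. $\operatorname{cx}(M)\le 1$.
   Context: All modules are finitely generated right modules. An algebra $A$ is selfinjective if $A$ is injective as a module over itself, so that projective and injective modules coincide. For an $A$-module $X$, $\operatorname{add}(X)$ denotes the full subcategory of the category of finitely generated $A$-modules whose objects are the direct summands of (finite) direct sums of copies of $X$. For $n\ge 1$, a finitely generated $A$-module $X$ is called maximal $n$-orthogonal if for every finitely generated $A$-module $M$ the following three conditions are equivalent: (i) $\operatorname{Ext}^i_A(M,X)=0$ for all $1\le i\le n$; (ii) $\operatorname{Ext}^i_A(X,M)=0$ for all $1\le i\le n$; (iii) $M\in\operatorname{add}(X)$. Complexity: for an $A$-module $M$ with minimal projective resolution $\cdots\to P_2\to P_1\to P_0\to M\to 0$, set $$\operatorname{cx}(M):=\inf\{b\in\mathbb{N}_0 \mid \exists\, c>0:\ \dim_K P_m\le c\,m^{b-1}\text{ for all } m\ge 1\},$$ if such $b$ exists, and $\operatorname{cx}(M)=\infty$ otherwise. Thus $\operatorname{cx}(M)\le 1$ if and only if the dimensions $\dim_K P_m$ are bounded. *)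

(* Defs.v *)
From HB Require Import structures.
From mathcomp Require Import all_boot all_order all_algebra falgebra.
From mathcomp Require Import all_classical all_reals ereal.
Set Implicit Arguments.
Unset Strict Implicit.
Unset Printing Implicit Defensive.
Import Order.TTheory GRing.Theory Num.Theory.
Local Open Scope classical_set_scope.
Local Open Scope ring_scope.

(* Right A-modules are left modules over the converse ring A^c: for a : A^c    *)
(* and x : M, the term a *: x stands for x.a, since a * b in A^c is b * a in A. *)

Definition fin_gen (S : pzRingType) (M : lmodType S) : Prop :=
  exists (d : nat) (g : 'I_d -> M),
    forall x : M, exists a : 'I_d -> S, x = \sum_(i < d) a i *: g i.

Record fgmod (K : fieldType) (A : falgType K) := FGMod {
  fgmod_sort :> lmodType A^c;
  fgmod_fin_gen : fin_gen fgmod_sort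
}.

Lemma fin_gen_regular (S : pzRingType) : fin_gen (S^o : lmodType S).
Proof.
exists 1, (fun=> 1 : S^o) => x; exists (fun=> x).
by rewrite big_ord1 -[LHS](mulr1 (x : S)).
Qed.

(* The right module A_A: here a *: x is the product x * a of A. *)
Definition regmod (K : fieldType) (A : falgType K) : fgmod A :=
  FGMod (fin_gen_regular A^c).

Definition surjective_lin (K : fieldType) (A : falgType K) (M N : fgmod A)
    (f : {linear M -> N}) : Prop :=
  forall y : N, exists x : M, f x = y.

Definition projective_mod (K : fieldType) (A : falgType K) (P : fgmod A) :
    Prop :=
  forall (M N : fgmod A) (p : {linear M -> N}) (f : {linear P -> N}),
    surjective_lin p -> exists g : {linear P -> M}, forall x, p (g x) = f x.

Definition injective_mod (K : fieldType) (A : falgType K) (I : fgmod A) :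
    Prop :=
  forall (M N : fgmod A) (j : {linear M -> N}) (f : {linear M -> I}),
    injective j -> exists g : {linear N -> I}, forall x, g (j x) = f x.

Definition selfinjective (K : fieldType) (A : falgType K) : Prop :=
  injective_mod (regmod A).

Definition in_add (K : fieldType) (A : falgType K) (X M : fgmod A) : Prop :=
  exists (k : nat) (N : fgmod A)
         (f : {linear (M * N)%type -> {ffun 'I_k -> X}}), bijective f.

Record proj_res (K : fieldType) (A : falgType K) (M : fgmod A) := ProjRes {
  pr_mod :> nat -> fgmod A;
  pr_diff : forall i, {linear pr_mod i.+1 -> pr_mod i};
  pr_aug : {linear pr_mod 0%N -> M};
  pr_projective : forall i, projective_mod (pr_mod i);
  pr_aug_surj : surjective_lin pr_aug;
  pr_aug_exact : forall x, pr_aug x = 0 <-> exists y, pr_diff 0 y = x;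
  pr_diff_exact :
    forall i x, pr_diff i x = 0 <-> exists y, pr_diff i.+1 y = x
}.

Definition cocycle (K : fieldType) (A : falgType K) (M N : fgmod A)
    (P : proj_res M) (i : nat) (f : {linear P i -> N}) : Prop :=
  forall x : P i.+1, f (pr_diff P i x) = 0.

Definition coboundary (K : fieldType) (A : falgType K) (M N : fgmod A)
    (P : proj_res M) (i : nat) : {linear P i -> N} -> Prop :=
  match i with
  | 0 => fun f => forall x, f x = 0
  | j.+1 => fun f =>
      exists g : {linear P j -> N}, forall x, f x = g (pr_diff P j x)
  end.

(* Ext^i_A(M, N) = H^i(Hom_A(P, N)) vanishes. *)
Definition Ext_eq0 (K : fieldType) (A : falgType K) (i : nat) (M N : fgmod A) :
    Prop :=
  forall (P : proj_res M) (f : {linear P i -> N}), cocycle f -> coboundary f.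

Definition maximal_orthogonal (K : fieldType) (A : falgType K) (n : nat)
    (X : fgmod A) : Prop :=
  forall M : fgmod A,
    ((forall i, (1 <= i <= n)%N -> Ext_eq0 i M X) <-> in_add X M) /\
    ((forall i, (1 <= i <= n)%N -> Ext_eq0 i X M) <-> in_add X M).

Definition superfluous_ker (K : fieldType) (A : falgType K) (P N : fgmod A)
    (f : {linear P -> N}) : Prop :=
  forall U : {pred P}, GRing.submod_closed U ->
    (forall x, exists u v, [/\ u \in U, f v = 0 & x = u + v]) ->
    forall x, x \in U.

(* P_0 -> M and the corestrictions P_(i+1) -> im d_i = ker d_(i-1) are         *)
(* projective covers, i.e. epimorphisms with superfluous kernel.              *)
Definition minimal_res (K : fieldType) (A : falgType K) (M : fgmod A)
    (P : proj_res M) : Prop :=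
  superfluous_ker (pr_aug P) /\ forall i, superfluous_ker (pr_diff P i).

(* K acts on M through the scalars k%:A of A. *)
Definition K_basis (K : fieldType) (A : falgType K) (M : fgmod A) (d : nat)
    (b : 'I_d -> M) : Prop :=
  forall x : M, exists! k : {ffun 'I_d -> K},
    x = \sum_(i < d) ((k i)%:A : A^c) *: b i.

(* A finitely generated module over A has a finite K-basis, so the default    *)
(* value 0 is never used.                                                     *)
Definition dimK (K : fieldType) (A : falgType K) (M : fgmod A) : nat :=
  xget 0%N [set d | exists b : 'I_d -> M, K_basis b].

(* Minimal projective resolutions are unique up to isomorphism, so that the   *)
(* choice of P is immaterial; ereal_inf set0 = +oo.                           *)
Definition cx (R : realType) (K : fieldType) (A : falgType K) (M : fgmod A) :
    \bar R :=
  ereal_inf [set (b%:R)%:E | b in [set b : nat |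
    exists (P : proj_res M) (c : R), [/\ minimal_res P, 0 < c &
      forall m : nat, (1 <= m)%N ->
        (dimK (P m))%:R <= c * m%:R ^ (b%:Z - 1)]]].

(* Main.v *)
(* The algebra A is right selfinjective; write T = DA for the dual module and     *)
(* G = Hom_A(T, -) for the inverse Nakayama functor. First, A embeds in a power   *)
(* of T, so it is a summand and T is a generator with endomorphism ring A. If e   *)
(* in End(T^k) = M_k(A), the idempotent with eM_k(A)e = A, were not full, the     *)
(* map from ideals of A to ideals of A induced by I |-> M_k(A) I M_k(A) would be  *)
(* strictly monotone without reaching A, against finite dimension; hence T is     *)
(* projective, G is an exact self-equivalence, and projectives are injective.     *)
(* Auslander-Reiten duality in the stable category shows that nu Omega^(n+2)      *)
(* preserves add X, where nu is the inverse of G. It also preserves the modules   *)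
(* with local stable endomorphism ring, and such a module in add X without        *)
(* projective summand is a summand of X, so its dimension is at most that of X.   *)
(* Since G preserves length, going around this loop bounds all the terms of a     *)
(* projective resolution of any module of add X. Finally n successive right       *)
(* X-approximations resolve an arbitrary module by modules of add X.              *)
From HB Require Import structures.
Require Import Defs.
From mathcomp Require Import all_boot all_order all_algebra falgebra.
From mathcomp Require Import all_classical all_reals ereal.
Set Implicit Arguments.
Unset Strict Implicit.
Unset Printing Implicit Defensive.
Import Order.TTheory GRing.Theory Num.Theory.
Local Open Scope ring_scope.

(** * Finite-dimensional vector spaces underlying modules *)

(** Vanishing of Ext is read in the stable category: by [Ext_stable_hom0], Ext^i(M, N) = 0 means
    that all maps from Omega^i M to N factor through projectives. This uses that projectives are
    injective ([proj_extend]); the duality below also needs DA to be projective, which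
    [dual_projective] derives from selfinjectivity.

    The engine is a loop inside add X. For Y in add X there are no stable maps from Omega^i Y to X
    for 1 <= i <= n, hence, after shifting, none from Omega^(n+1) Y to Omega^j X for 1 <= j <= n.
    Duality ([nakayama_exists]) reverses the arrow: there are none from Omega^j X to Y1 = nu
    Omega^(n+2) Y, and orthogonality puts Y1 back in add X ([in_add_nakayama]).

    The loop does not make modules grow. If Y has a local stable endomorphism ring, so has Y1;
    stripped of its projective summands, Y1 becomes a summand of a power of X that embeds in X
    itself ([stably_local_kdim]). Each turn therefore contributes a fixed number of projective terms
    of bounded size, which gives [bound_stably_local]. Sizes are measured by length, because the
    equivalence G preserves length but need not preserve dimension; [kdim_len_le] converts back.

    Splitting into indecomposables extends the bound to add X ([bound_in_add]), n successive
    approximations extend it to every module ([bound_all]), and [min_res_bound] carries it to the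
    minimal resolution. *)

Definition mklin (S : pzRingType) (U V : lmodType S) (f : U -> V)
    (hf : linear f) : {linear U -> V} :=
  HB.pack f (GRing.isLinear.Build S U V _ f hf).

(** A subspace of largest dimension among those inside [U] is all of [U], since a vector of [U]
    outside it would enlarge it. Submodules and spans can thus be described by a [Prop]. *)
Lemma vspace_of_pred (K : fieldType) (V : vectType K) (U : V -> Prop) :
  U 0 -> (forall a u v, U u -> U v -> U (a *: u + v)) ->
  exists W : {vspace V}, forall v, v \in W <-> U v.
Proof.
move=> U0 Ul.
pose P d := `[< exists2 W : {vspace V}, \dim W = d & forall v, v \in W -> U v >].
have exP : exists d, P d.
  exists 0%N; apply/asboolP; exists 0%VS; first exact: dimv0.
  by move=> v; rewrite memv0 => /eqP->.
have ubP d : P d -> (d <= \dim {:V})%N.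
  by move=> /asboolP[W <- _]; apply: dimvS; exact: subvf.
case: (ex_maxnP exP ubP) => d /asboolP[W dW WU] dmax.
exists W => v; split; first exact: WU.
move=> Uv; apply: contrapT => /negP vW.
have /dmax : P (\dim (W + <[v]>)).
  apply/asboolP; exists (W + <[v]>)%VS => // w /memv_addP[w1 w1W [w2 /vlineP[k ->] ->]].
  by rewrite addrC; apply: Ul => //; exact: WU.
rewrite leqNgt -dW => /negP; apply.
rewrite (ltn_leqif (dimv_leqif_sup (addvSl _ _))) subv_add subvv /=.
by apply: contra vW; rewrite memvE.
Qed.

Section FinGen.
Variables (K : fieldType) (A : falgType K).

(** The image is a [K]-subspace, and preimages of a basis of it generate already over the scalars of
    [K]. The modules constructed below owe their finite generation to such an embedding. *)
Lemma fin_gen_inj (N : lmodType A^c) (V : vectType K) (j : N -> V) :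
  {morph j : x y / x + y} ->
  (forall (k : K) x, j ((k%:A : A^c) *: x) = k *: j x) -> injective j ->
  fin_gen N.
Proof.
move=> jD jZ jI.
have j0 : j 0 = 0 by have := jZ 0 0; rewrite !scale0r.
have [W WP] : exists W : {vspace V}, forall v, v \in W <-> exists x, j x = v.
  apply: vspace_of_pred; first by exists 0.
  by move=> a _ _ [x <-] [y <-]; exists ((a%:A : A^c) *: x + y); rewrite jD jZ.
have gP i : exists x, j x = (vbasis W)`_i.
  case: (ltnP i (size (vbasis W))) => hi; first by apply/WP/vbasis_mem/mem_nth.
  by exists 0; rewrite nth_default.
have [g gE] := choice gP.
exists (\dim W), (fun i => g i) => x.
have xW : j x \in W by apply/WP; exists x.
exists (fun i => (coord (vbasis W) i (j x))%:A : A^c).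
apply: jI; rewrite {1}(coord_vbasis xW).
elim/big_ind2: _ => //= [u1 v1 u2 v2 -> ->|i _]; first by rewrite jD.
by rewrite jZ gE.
Qed.

(** An alias of [M], so that its [K]-structure does not clash with the [A^c]-structure on the same
    carrier. *)
Definition kvec (M : fgmod A) : Type := M.

Section KvecZmod.
Variable M : fgmod A.
HB.instance Definition _ := GRing.Zmodule.copy (kvec M) M.

Definition kscale (k : K) (x : kvec M) : kvec M := (k%:A : A^c) *: (x : M).

Fact kscaleA a b v : kscale a (kscale b v) = kscale (a * b) v.
Proof.
rewrite /kscale scalerA; congr (_ *: _).
by rewrite -[LHS]/((b%:A : A) * a%:A) -scalerAl mul1r scalerA mulrC.
Qed.
Fact kscale1 : left_id 1 kscale.
Proof. by move=> x; rewrite /kscale scale1r scale1r. Qed.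
Fact kscaleDr : right_distributive kscale +%R.
Proof. by move=> k x y; rewrite /kscale scalerDr. Qed.
Fact kscaleDl v : {morph kscale^~ v : a b / a + b}.
Proof.
move=> a b; have := @scalerDl A^c M (v : M) (a%:A) (b%:A) => <-.
by congr (_ *: _); exact: scalerDl.
Qed.
HB.instance Definition _ :=
  GRing.Zmodule_isLmodule.Build K (kvec M) kscaleA kscale1 kscaleDr kscaleDl.

Lemma kscaleE (k : K) (x : kvec M) : k *: x = (k%:A : A^c) *: (x : M).
Proof. by []. Qed.

(** A complement of the kernel of a surjection A^d -> M is isomorphic to M over [K], and its
    coordinates serve for M. *)
Fact kvec_vector : exists n, exists f : kvec M -> 'rV[K]_n, linear f /\ bijective f.
Proof.
have [d [g gP]] := fgmod_fin_gen M.
pose V : vectType K := {ffun 'I_d -> A}.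
pose p (a : V) : M := \sum_(i < d) (a i : A^c) *: g i.
have pE k a b : p (k *: a + b) = (k%:A : A^c) *: p a + p b.
  rewrite /p scaler_sumr -big_split /=; apply: eq_bigr => i _.
  rewrite scalerA -scalerDl !ffunE; congr (_ *: _); congr (_ + _).
  by rewrite -[RHS]/((a i : A) * k%:A) -scalerAr mulr1.
have pL : linear (p : V -> kvec M) by exact: pE.
pose pl := mklin pL.
have [W WP] : exists W : {vspace V}, forall v, v \in W <-> pl v = 0.
  apply: vspace_of_pred; first exact: linear0.
  by move=> a u v pu pv; rewrite linearP pu pv scaler0 addr0.
have xP (x : kvec M) : exists s : subvs_of (W^C)%VS, pl (vsval s) = x.
  have [a xE] := gP x; pose v : V := [ffun i => a i].
  have -> : x = pl v by rewrite xE; apply: eq_bigr => i _; rewrite ffunE.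
  have /memv_addP[w wW [u uW vE]] : v \in (W + W^C)%VS by rewrite addv_complf memvf.
  have pw : pl w = 0 by apply/WP.
  by exists (Subvs uW); rewrite vE linearD pw add0r.
have [f fP] := choice xP.
have plI (s t : subvs_of (W^C)%VS) : pl (vsval s) = pl (vsval t) -> s = t.
  move=> e; apply: subvs_inj; apply/eqP; rewrite -subr_eq0 -memv0 -(capv_compl W).
  rewrite memv_cap; apply/andP; split; first by apply/WP; rewrite linearB e subrr.
  by apply: memvB; exact: subvsP.
have fL : linear f.
  move=> k x y; apply: plI; rewrite fP.
  have -> : vsval (k *: f x + f y) = k *: vsval (f x) + vsval (f y) by exact: linearP.
  by rewrite linearP !fP.
pose b := vbasis {:subvs_of (W^C)%VS}; pose n : nat := \dim {:subvs_of (W^C)%VS}.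
have bF : free b by exact: basis_free (vbasisP _).
exists n, (fun x => \row_i coord b i (f x)); split.
  by move=> k x y; apply/rowP => i; rewrite fL !mxE linearP.
exists (fun r : 'rV[K]_n => pl (vsval (\sum_(i < n) r 0 i *: b`_i))) => [x|r].
  rewrite -[RHS]fP [in RHS](coord_vbasis (memvf (f x))).
  by congr (pl (vsval _)); apply: eq_bigr => i _; rewrite mxE.
apply/rowP => i; rewrite mxE; set s := \sum_i _.
have -> : f (pl (vsval s)) = s by apply: plI; rewrite fP.
exact: coord_sum_free.
Qed.

Fact kvec_vector_axiom : vector_axiom_def (sval (cid kvec_vector)) (kvec M).
Proof.
case: (cid kvec_vector) => n /= H; case: (cid H) => f [fl fb].
by exists f.
Qed.
HB.instance Definition _ := Lmodule_hasFinDim.Build K (kvec M) kvec_vector_axiom.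
End KvecZmod.

End FinGen.

Section Dim.
Variables (K : fieldType) (A : falgType K).
Implicit Types M N X Y Z P Q : fgmod A.

Definition kdim M : nat := dim (kvec M).

Definition klin M N (f : {linear M -> N}) : kvec M -> kvec N := f.

Section Klin.
Variables (M N : fgmod A) (f : {linear M -> N}).
Fact klin_linear : linear (klin f).
Proof. by move=> k x y; rewrite /klin kscaleE; exact: linearP. Qed.
HB.instance Definition _ := GRing.isLinear.Build K (kvec M) (kvec N) _ (klin f)
  klin_linear.
End Klin.

Lemma dim_inj (V W : vectType K) (f : {linear V -> W}) :
  injective f -> (dim V <= dim W)%N.
Proof.
move=> fI; have k0 : lker (linfun f) == 0%VS.
  by apply/lker0P => x y; rewrite !lfunE; exact: fI.
rewrite -dimvf -(limg_dim_eq (f := linfun f)); first by rewrite -(dimvf W) dimvS // subvf.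
by rewrite (eqP k0) capv0.
Qed.

Lemma dim_inj_bij (V W : vectType K) (f : {linear V -> W}) :
  injective f -> (dim W <= dim V)%N -> forall y, exists x, f x = y.
Proof.
move=> fI le y; have k0 : lker (linfun f) == 0%VS.
  by apply/lker0P => x z; rewrite !lfunE; exact: fI.
have : (fullv <= limg (linfun f))%VS.
  rewrite -(geq_leqif (dimv_leqif_sup (subvf _))) limg_dim_eq ?(eqP k0) ?capv0 //.
  by rewrite !dimvf.
by move=> /subvP/(_ y (memvf _))/memv_imgP[x _ ->]; exists x; rewrite lfunE.
Qed.

Lemma dim_surj (V W : vectType K) (f : {linear V -> W}) :
  (forall y, exists x, f x = y) -> (dim W <= dim V)%N.
Proof.
move=> fS; rewrite -(dimvf V) -(dimvf W) -(limg_ker_dim (linfun f) fullv).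
apply: leq_trans (leq_addl _ _); apply: dimvS; apply/subvP => y _.
by have [x <-] := fS y; rewrite -(lfunE f) memv_img // memvf.
Qed.

Lemma dim_surj_bij (V W : vectType K) (f : {linear V -> W}) :
  (forall y, exists x, f x = y) -> (dim V <= dim W)%N -> injective f.
Proof.
move=> fS le.
have l0 : limg (linfun f) = fullv.
  apply/eqP; rewrite eqEsubv subvf; apply/subvP => y _.
  by have [x <-] := fS y; rewrite -(lfunE f) memv_img // memvf.
have := limg_ker_dim (linfun f) fullv; rewrite l0 !dimvf capfv => e.
have /eqP : \dim (lker (linfun f)) = 0%N.
  by apply/eqP; rewrite -leqn0 -(leq_add2r (dim W)) e.
rewrite dimv_eq0 => /lker0P fI x y e'; apply: fI; rewrite !lfunE; exact: e'.
Qed.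

Lemma kdim_inj M N (f : {linear M -> N}) : injective f -> (kdim M <= kdim N)%N.
Proof. by move=> fI; apply: (@dim_inj _ _ (klin f)). Qed.

Lemma kdim_inj_bij M N (f : {linear M -> N}) :
  injective f -> (kdim N <= kdim M)%N -> surjective_lin f.
Proof. by move=> fI; apply: (@dim_inj_bij _ _ (klin f)). Qed.

Lemma kdim_surj M N (f : {linear M -> N}) :
  surjective_lin f -> (kdim N <= kdim M)%N.
Proof. by move=> fS; apply: (@dim_surj _ _ (klin f)). Qed.

Lemma kdim_surj_bij M N (f : {linear M -> N}) :
  surjective_lin f -> (kdim M <= kdim N)%N -> injective f.
Proof. by move=> fS; apply: (@dim_surj_bij _ _ (klin f)). Qed.

Lemma kdim_eq0 M : kdim M = 0%N -> forall x : M, x = 0.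
Proof.
move=> d0 x; have : (x : kvec M) \in fullv by exact: memvf.
have /eqP -> : (fullv : {vspace kvec M}) == 0%VS by rewrite -dimv_eq0 dimvf; apply/eqP.
by rewrite memv0 => /eqP.
Qed.

Lemma K_basisP M d (b : 'I_d -> M) : K_basis b -> d = kdim M.
Proof.
move=> bP; pose V : vectType K := {ffun 'I_d -> K^o}.
pose f (k : V) : kvec M := \sum_(i < d) (k i : K) *: (b i : kvec M).
have fL : linear f.
  move=> a u v; rewrite /f scaler_sumr -big_split /=; apply: eq_bigr => i _.
  by rewrite !ffunE scalerDl scalerA.
have fE k : f k = \sum_(i < d) ((k i)%:A : A^c) *: b i by [].
have fS y : exists x, mklin fL y = x by exists (mklin fL y).
have S y : exists x, mklin fL x = y by have [k [kE _]] := bP y; exists k.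
have I : injective (mklin fL).
  move=> u v /= e; have [k [kE ku]] := bP (f u).
  have -> : u = k by rewrite (ku u).
  by rewrite (ku v) // e.
have := dim_inj I; have := dim_surj S => h1 h2.
have -> : d = dim V by rewrite /dim /= card_ord muln1.
by apply/eqP; rewrite eqn_leq h1 h2.
Qed.

Lemma dimKE M : dimK M = kdim M.
Proof.
have [b bP] : exists b : 'I_(kdim M) -> M, K_basis b.
  rewrite /kdim -dimvf; pose b := vbasis {:kvec M}.
  have bF : free b by exact: basis_free (vbasisP _).
  exists (fun i => b`_i) => x; exists [ffun i => coord b i x]; split.
    rewrite {1}(coord_vbasis (memvf (x : kvec M))).
    by under [RHS]eq_bigr => i _ do rewrite ffunE.
  move=> k e; apply/ffunP => i; rewrite ffunE e.
  exact: (coord_sum_free (fun i => k i) i bF).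
rewrite /dimK; case: xgetP => [d _ [c cP]|/(_ (kdim M)) []].
  exact: K_basisP cP.
by exists b.
Qed.

Lemma fin_gen_prod M N : fin_gen (M * N)%type.
Proof.
apply: (@fin_gen_inj _ _ _ (kvec M * kvec N)%type (fun x => (x.1, x.2))) => //.
by move=> [a b] [c d] [-> ->].
Qed.
Definition prodm M N : fgmod A := FGMod (fin_gen_prod M N).

Lemma fin_gen_ffun k M : fin_gen {ffun 'I_k -> M}.
Proof.
apply: (@fin_gen_inj _ _ _ {ffun 'I_k -> kvec M} (fun x => x)) => //.
Qed.
Definition ffunm k M : fgmod A := FGMod (fin_gen_ffun k M).

Lemma kdim_prod M N : kdim (prodm M N) = (kdim M + kdim N)%N.
Proof.
pose f (x : kvec (prodm M N)) : (kvec M * kvec N)%type := x.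
pose g (x : (kvec M * kvec N)%type) : kvec (prodm M N) := x.
have fL : linear f by []. have gL : linear g by [].
apply/eqP; rewrite eqn_leq; apply/andP; split.
  by apply: (@dim_inj _ _ (mklin fL)).
by apply: (@dim_inj _ _ (mklin gL)).
Qed.

Lemma kdim_ffun k M : kdim (ffunm k M) = (k * kdim M)%N.
Proof.
pose f (x : kvec (ffunm k M)) : {ffun 'I_k -> kvec M} := x.
pose g (x : {ffun 'I_k -> kvec M}) : kvec (ffunm k M) := x.
have fL : linear f by []. have gL : linear g by [].
have -> : (k * kdim M)%N = dim {ffun 'I_k -> kvec M} by rewrite /dim /= card_ord.
apply/eqP; rewrite eqn_leq; apply/andP; split.
  by apply: (@dim_inj _ _ (mklin fL)).
by apply: (@dim_inj _ _ (mklin gL)).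
Qed.

End Dim.

(** * Submodules given by predicates *)

Section SubModule.
Variables (K : fieldType) (A : falgType K) (V : lmodType A^c) (U : V -> Prop).
Hypotheses (U0 : U 0) (Ul : forall a u v, U u -> U v -> U (a *: u + v)).

Let S : {pred V} := fun x => `[< U x >].
Fact subS : GRing.submod_closed S.
Proof.
split; first exact/asboolP.
by move=> a u v /asboolP uU /asboolP vU; apply/asboolP/Ul.
Qed.
HB.instance Definition _ := GRing.isSubmodClosed.Build A^c V S subS.
Let subT := {x : V | x \in S}.
HB.instance Definition _ := SubType.copy subT {x : V | x \in S}.
HB.instance Definition _ := Choice.copy subT {x : V | x \in S}.
HB.instance Definition _ := [SubChoice_isSubLmodule of subT by <:].

Lemma submod_exists (W : vectType K) (j : V -> W) :
  {morph j : x y / x + y} ->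
  (forall (k : K) x, j ((k%:A : A^c) *: x) = k *: j x) -> injective j ->
  exists (N : fgmod A) (i : {linear N -> V}),
    injective i /\ forall x, U x <-> exists y, i y = x.
Proof.
move=> jD jZ jI.
have fg : fin_gen (subT : lmodType A^c).
  apply: (@fin_gen_inj _ _ _ W (fun x => j (val x))) => [x y|k x|x y /jI/val_inj//].
    by rewrite raddfD jD.
  by rewrite linearZ jZ.
exists (FGMod fg), (val : {linear subT -> V}); split; first exact: val_inj.
move=> x; split => [Ux|[y <-]]; last by apply/asboolP; exact: (valP y).
have xS : x \in S by exact/asboolP.
by exists (exist _ x xS : subT).
Qed.
End SubModule.

(** * Exact sequences, free modules and projective modules *)

Section Modules.
Variables (K : fieldType) (A : falgType K).
Implicit Types M N X Y Z P Q I : fgmod A.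

Lemma submod_of_pred M (U : M -> Prop) :
  U 0 -> (forall a u v, U u -> U v -> U (a *: u + v)) ->
  exists (N : fgmod A) (i : {linear N -> M}),
    injective i /\ forall x, U x <-> exists y, i y = x.
Proof. by move=> U0 Ul; apply: (@submod_exists _ _ _ _ U0 Ul (kvec M) (fun x => x)). Qed.

Lemma lin_fact_surj P N M (p : {linear P -> N}) (h : {linear P -> M}) :
  surjective_lin p -> (forall x, p x = 0 -> h x = 0) ->
  exists c : {linear N -> M}, forall x, c (p x) = h x.
Proof.
move=> pS ph; have [s sP] := choice pS.
have hE x y : p x = p y -> h x = h y.
  move=> e; apply/eqP; rewrite -subr_eq0 -linearB; apply/eqP/ph.
  by rewrite linearB e subrr.
have cL : linear (fun y => h (s y)).
  by move=> a x y; rewrite -linearP; apply: hE; rewrite linearP !sP.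
by exists (mklin cL) => x; apply: hE; rewrite sP.
Qed.

Lemma lin_fact_inj Z M P (j : {linear Z -> M}) (h : {linear P -> M}) :
  injective j -> (forall x, exists z, j z = h x) ->
  exists c : {linear P -> Z}, forall x, j (c x) = h x.
Proof.
move=> jI hj; have [c cP] := choice hj.
have cL : linear c by move=> a x y; apply: jI; rewrite linearP !cP linearP.
by exists (mklin cL).
Qed.

Lemma lin_inv M N (f : {linear M -> N}) : bijective f ->
  exists g : {linear N -> M}, cancel f g /\ cancel g f.
Proof.
case=> g fK gK; have gL : linear g.
  by move=> a x y; apply: (can_inj fK); rewrite linearP !gK.
by exists (mklin gL).
Qed.

Lemma inj_surj_bij M N (f : {linear M -> N}) :
  injective f -> surjective_lin f -> bijective f.
Proof.
by move=> fI /choice[g gP]; exists g => // x; apply: fI; rewrite gP.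
Qed.

Lemma lin_eq0_inj M N (f : {linear M -> N}) :
  (forall x, f x = 0 -> x = 0) -> injective f.
Proof.
move=> f0 x y e; apply/eqP; rewrite -subr_eq0; apply/eqP/f0.
by rewrite linearB e subrr.
Qed.

Lemma ker_exists M N (f : {linear M -> N}) :
  exists Z (i : {linear Z -> M}), injective i /\
    forall x, f x = 0 <-> exists z, i z = x.
Proof.
apply: submod_of_pred; first exact: linear0.
by move=> a u v fu fv; rewrite linearP fu fv scaler0 addr0.
Qed.

Lemma im_exists M N (f : {linear M -> N}) :
  exists I (q : {linear M -> I}) (i : {linear I -> N}),
    [/\ surjective_lin q, injective i & forall x, i (q x) = f x].
Proof.
have [||I [i [iI iP]]] := @submod_of_pred N (fun y => exists x, f x = y).
- by exists 0; rewrite linear0.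
- by move=> a _ _ [u <-] [v <-]; exists (a *: u + v); rewrite linearP.
have [|q qP] := @lin_fact_inj _ _ _ i f iI; first by move=> x; apply/iP; exists x.
exists I, q, i; split => // y.
have /iP[x xE] : exists z, i z = i y by exists y.
by exists x; apply: iI; rewrite qP.
Qed.

Definition ses Z P N (i : {linear Z -> P}) (p : {linear P -> N}) : Prop :=
  [/\ injective i, surjective_lin p & forall x, p x = 0 <-> exists z, i z = x].

Lemma ses_comp0 Z P N (i : {linear Z -> P}) (p : {linear P -> N}) z :
  ses i p -> p (i z) = 0.
Proof. by case=> _ _ H; apply/H; exists z. Qed.

Lemma ses_ker P N (p : {linear P -> N}) : surjective_lin p ->
  exists Z (i : {linear Z -> P}), ses i p.
Proof. by move=> pS; have [Z [i [iI iP]]] := ker_exists p; exists Z, i; split. Qed.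

Definition lin_comb (S : pzRingType) (M : lmodType S) k (m : 'I_k -> M)
  (x : {ffun 'I_k -> S^o}) : M := \sum_i (x i : S) *: m i.
Fact lin_comb_linear (S : pzRingType) (M : lmodType S) k (m : 'I_k -> M) :
  linear (lin_comb m).
Proof.
move=> a x y; rewrite /lin_comb scaler_sumr -big_split; apply: eq_bigr => i _.
by rewrite !ffunE scalerDl scalerA.
Qed.
HB.instance Definition _ (S : pzRingType) (M : lmodType S) k (m : 'I_k -> M) :=
  GRing.isLinear.Build S _ M _ (lin_comb m) (lin_comb_linear m).

Definition freem k : fgmod A := ffunm k (regmod A).
Definition comb M k (m : 'I_k -> M) : {linear freem k -> M} := lin_comb m.
Definition freeb k (i : 'I_k) : freem k := [ffun j => (j == i)%:R : A^c].

Lemma combE M k (m : 'I_k -> M) x : comb m x = \sum_i (x i : A^c) *: m i.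
Proof. by []. Qed.

Lemma comb_freeb M k (m : 'I_k -> M) i : comb m (freeb i) = m i.
Proof.
rewrite combE (bigD1 i) //= ffunE eqxx scale1r big1 ?addr0 // => j /negPf ji.
by rewrite ffunE ji scale0r.
Qed.

Lemma free_expand k (x : freem k) : x = \sum_i (x i : A^c) *: freeb i.
Proof.
apply/ffunP => j; rewrite sum_ffunE (bigD1 j) //= !ffunE eqxx.
rewrite big1 => [|i ij]; last by rewrite !ffunE eq_sym (negPf ij) scaler0.
by rewrite addr0 -[RHS]/((x j : A^c) * 1) mulr1.
Qed.

Lemma lin_freeE M k (f : {linear freem k -> M}) x :
  f x = \sum_i (x i : A^c) *: f (freeb i).
Proof. by rewrite {1}(free_expand x) linear_sum; apply: eq_bigr => i _; rewrite linearZ. Qed.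

Lemma free_projective k : projective_mod (freem k).
Proof.
move=> M N p f pS.
have [m mP] := choice (fun i => pS (f (freeb i))).
exists (comb m) => x; rewrite combE linear_sum (lin_freeE f).
by apply: eq_bigr => i _; rewrite linearZ mP.
Qed.

(** A [K]-basis generates over A as well. Taking its size as the rank gives the free syzygies below
    explicit dimension bounds. *)
Lemma free_cover M : exists p : {linear freem (kdim M) -> M}, surjective_lin p.
Proof.
pose b := vbasis {:kvec M}.
have eD : \dim {:kvec M} = kdim M by rewrite dimvf.
exists (comb (fun i => b`_i)) => x.
exists [ffun i : 'I_(kdim M) => (coord b (cast_ord (esym eD) i) x)%:A : A^c].
rewrite [RHS](coord_vbasis (memvf (x : kvec M))) combE.
rewrite (reindex (cast_ord (esym eD))) /=; last first.
  by exists (cast_ord eD) => i _; rewrite ?cast_ordK ?cast_ordKV.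
by apply: eq_bigr => i _; rewrite ffunE.
Qed.

Definition ffproj k M (i : 'I_k) (x : ffunm k M) : M := x i.
Fact ffproj_linear k M (i : 'I_k) : linear (@ffproj k M i).
Proof. by move=> a x y; rewrite /ffproj !ffunE. Qed.
HB.instance Definition _ k M (i : 'I_k) :=
  GRing.isLinear.Build A^c (ffunm k M) M _ (@ffproj k M i) (@ffproj_linear k M i).

Definition ffin k M (i : 'I_k) (x : M) : ffunm k M := [ffun j => if j == i then x else 0].
Fact ffin_linear k M (i : 'I_k) : linear (@ffin k M i).
Proof.
by move=> a x y; apply/ffunP => j; rewrite !ffunE; case: eqP; rewrite ?scaler0 ?addr0.
Qed.
HB.instance Definition _ k M (i : 'I_k) :=
  GRing.isLinear.Build A^c M (ffunm k M) _ (@ffin k M i) (@ffin_linear k M i).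

Lemma ffin_sum k M (x : ffunm k M) : x = \sum_i ffin i (x i).
Proof.
apply/ffunP => j; rewrite sum_ffunE (bigD1 j) //= !ffunE eqxx.
by rewrite big1 ?addr0 // => i ij; rewrite !ffunE eq_sym (negPf ij).
Qed.

Definition fftuple k M N (f : 'I_k -> {linear M -> N}) (x : M) : ffunm k N :=
  [ffun i => f i x].
Fact fftuple_linear k M N (f : 'I_k -> {linear M -> N}) : linear (fftuple f).
Proof. by move=> a x y; apply/ffunP => i; rewrite !ffunE linearP. Qed.
HB.instance Definition _ k M N (f : 'I_k -> {linear M -> N}) :=
  GRing.isLinear.Build A^c M (ffunm k N) _ (fftuple f) (fftuple_linear f).

Definition ffcotuple k M N (f : 'I_k -> {linear M -> N}) (x : ffunm k M) : N :=
  \sum_i f i (x i).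
Fact ffcotuple_linear k M N (f : 'I_k -> {linear M -> N}) : linear (ffcotuple f).
Proof.
move=> a x y; rewrite /ffcotuple scaler_sumr -big_split; apply: eq_bigr => i _.
by rewrite !ffunE linearP.
Qed.
HB.instance Definition _ k M N (f : 'I_k -> {linear M -> N}) :=
  GRing.isLinear.Build A^c (ffunm k M) N _ (ffcotuple f) (ffcotuple_linear f).

Lemma retract_projective P Q (s : {linear Q -> P}) (r : {linear P -> Q}) :
  (forall x, r (s x) = x) -> projective_mod P -> projective_mod Q.
Proof.
move=> rs pP M N p f pS; have [g gP] := pP M N p (f \o r : {linear P -> N}) pS.
by exists (g \o s : {linear Q -> M}) => x /=; rewrite gP /= rs.
Qed.

Lemma ker_ses_split M N (s : {linear N -> M}) (r : {linear M -> N}) :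
  (forall x, r (s x) = x) -> exists Q (i : {linear Q -> M}) (q : {linear M -> Q}),
   [/\ ses i r, forall x, q (i x) = x & forall x, i (q x) = x - s (r x)].
Proof.
move=> rs; have rS : surjective_lin r by move=> y; exists (s y).
have [Q [i iS]] := ses_ker rS; have [iI _ iP] := iS.
have [|q qP] := @lin_fact_inj _ _ _ i (idfun \- (s \o r) : {linear M -> M}) iI.
  by move=> x; apply/iP; rewrite linearB /= rs subrr.
exists Q, i, q; split => // x; apply: iI; rewrite qP /=.
by rewrite (ses_comp0 _ iS) linear0 subr0.
Qed.

Lemma prod_projective P Q :
  projective_mod P -> projective_mod Q -> projective_mod (prodm P Q).
Proof.
move=> pP pQ M N p f pS.
have i1L : linear (fun x : P => (x, 0) : prodm P Q).
  move=> a x y; have e : (0 : Q) = a *: 0 + 0 by rewrite scaler0 addr0.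
  by congr (_, _).
have i2L : linear (fun x : Q => (0, x) : prodm P Q).
  move=> a x y; have e : (0 : P) = a *: 0 + 0 by rewrite scaler0 addr0.
  by congr (_, _).
have [g1 g1P] := pP M N p (f \o mklin i1L : {linear P -> N}) pS.
have [g2 g2P] := pQ M N p (f \o mklin i2L : {linear Q -> N}) pS.
have gL : linear (fun x : prodm P Q => g1 x.1 + g2 x.2).
  by move=> a x y; rewrite /= !linearP scalerDr addrACA.
exists (mklin gL) => -[x y] /=; rewrite linearD g1P g2P /= -linearD; congr (f _).
by congr (_, _); rewrite ?addr0 ?add0r.
Qed.

End Modules.

(** * The dual module DA *)

Section Dual.
Variables (K : fieldType) (A : falgType K).
Implicit Types M N X Y Z P Q I : fgmod A.

Definition dualA : Type := 'Hom(A, K^o).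
HB.instance Definition _ := GRing.Zmodule.copy dualA 'Hom(A, K^o).

Definition dual_fun (phi : dualA) : A -> K := (phi : 'Hom(A, K^o)).

Definition dual_of (f : A -> K) : dualA := linfun (f : A -> K^o).

Lemma dual_ext (phi psi : dualA) : (forall x, dual_fun phi x = dual_fun psi x) -> phi = psi.
Proof. by move=> H; apply/lfunP. Qed.

Lemma dual_ofE (f : A -> K) : linear (f : A -> K^o) -> forall x, dual_fun (dual_of f) x = f x.
Proof. by move=> fL x; exact: (lfunE (mklin fL)). Qed.

Lemma dual_funP (phi : dualA) (k : K) x y :
  dual_fun phi (k *: x + y) = k * dual_fun phi x + dual_fun phi y.
Proof. by rewrite /dual_fun linearP. Qed.

Lemma dual_funD (phi psi : dualA) x :
  dual_fun (phi + psi) x = dual_fun phi x + dual_fun psi x.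
Proof. exact: (@add_lfunE K A K^o (phi : 'Hom(A, K^o)) psi x). Qed.

Lemma dual_fun0 x : dual_fun 0 x = 0.
Proof. exact: (@zero_lfunE K A K^o x). Qed.

Definition dual_scale (a : A^c) (phi : dualA) : dualA :=
  dual_of (fun x => dual_fun phi ((a : A) * x)).

Lemma dual_scaleE a phi x : dual_fun (dual_scale a phi) x = dual_fun phi ((a : A) * x).
Proof.
by apply: dual_ofE => k u v; rewrite mulrDr -scalerAr dual_funP.
Qed.

Fact dual_scaleA a b v : dual_scale a (dual_scale b v) = dual_scale (a * b) v.
Proof. by apply: dual_ext => x; rewrite !dual_scaleE mulrA. Qed.
Fact dual_scale1 : left_id 1 dual_scale.
Proof. by move=> v; apply: dual_ext => x; rewrite dual_scaleE mul1r. Qed.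
Fact dual_scaleDr : right_distributive dual_scale +%R.
Proof. by move=> a u v; apply: dual_ext => x; rewrite dual_scaleE !dual_funD !dual_scaleE. Qed.
Fact dual_scaleDl v : {morph dual_scale^~ v : a b / a + b}.
Proof.
move=> a b; apply: dual_ext => x; rewrite dual_scaleE dual_funD !dual_scaleE mulrDl.
by rewrite -[X in dual_fun _ (X + _)]scale1r dual_funP mul1r.
Qed.
HB.instance Definition _ := GRing.Zmodule_isLmodule.Build A^c dualA
  dual_scaleA dual_scale1 dual_scaleDr dual_scaleDl.

Lemma dual_funZ (a : A^c) (phi : dualA) x : dual_fun (a *: phi) x = dual_fun phi ((a : A) * x).
Proof. exact: dual_scaleE. Qed.

Lemma fin_gen_dual : fin_gen dualA.
Proof.
apply: (@fin_gen_inj K A dualA 'Hom(A, K^o) (fun x : dualA => (x : 'Hom(A, K^o)))) => // k x.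
apply: dual_ext => y; rewrite dual_funZ -scalerAl mul1r.
by rewrite /dual_fun linearZ scale_lfunE.
Qed.
Definition dualm : fgmod A := FGMod fin_gen_dual.

Lemma functional_exists (V : vectType K) (W : {vspace V}) v : v \notin W ->
  exists eta : 'Hom(V, K^o), (forall w, w \in W -> eta w = 0) /\ eta v != 0.
Proof.
move=> vW; pose p := projv (W^C)%VS.
have pW w : w \in W -> projv W w = w by move=> h; rewrite projv_id.
pose u := v - projv W v.
have u0 : u != 0.
  by apply: contra vW; rewrite subr_eq0 => /eqP ->; exact: memv_proj.
pose b := vbasis {:V}.
have [i ci] : exists i, coord b i u != 0.
  apply: contrapT => /forallNP H; case/eqP: u0.
  rewrite (coord_vbasis (memvf u)) big1 // => i _.
  by have /negP := H i; rewrite negbK => /eqP ->; rewrite scale0r.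
have L : linear (fun x => coord b i x : K^o) by move=> k x y; rewrite linearP.
exists (linfun (mklin L) \o (\1 - projv W))%VF.
have E x : (linfun (mklin L) \o (\1 - projv W))%VF x = coord b i (x - projv W x).
  by rewrite comp_lfunE lfunE add_lfunE opp_lfunE id_lfunE.
by split => [w wW|]; rewrite E // pW // subrr linear0.
Qed.

Lemma functional_nz (V : vectType K) (v : V) : v != 0 -> exists eta : 'Hom(V, K^o), eta v != 0.
Proof.
move=> v0; have [|e [_ ev]] := @functional_exists V 0%VS v; first by rewrite memv0.
by exists e.
Qed.

(* The map M -> DA adjoint to a functional on M. *)
Definition hat M (eta : 'Hom(kvec M, K^o)) (m : M) : dualm :=
  dual_of (fun a => eta ((a : A^c) *: m)).

Lemma hatE M (eta : 'Hom(kvec M, K^o)) (m : M) a :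
  dual_fun (hat eta m) a = eta ((a : A^c) *: m).
Proof.
apply: dual_ofE => k x y.
have e : (k *: x + y : A^c) *: m = (k%:A : A^c) *: ((x : A^c) *: m) + (y : A^c) *: m.
  rewrite scalerA -scalerDl; congr (_ *: m); congr (_ + _).
  by rewrite -[RHS]/((x : A) * k%:A) -scalerAr mulr1.
exact: etrans (congr1 eta e) (linearP eta k (_ : kvec M) _).
Qed.

Fact hat_linear M (eta : 'Hom(kvec M, K^o)) : linear (hat eta).
Proof.
move=> b x y; apply: dual_ext => a; rewrite hatE dual_funD dual_funZ !hatE.
by rewrite scalerDr scalerA; exact: (raddfD eta (_ : kvec M) _).
Qed.
HB.instance Definition _ M (eta : 'Hom(kvec M, K^o)) :=
  GRing.isLinear.Build A^c M dualm _ (hat eta) (hat_linear eta).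

(** The adjoints of the coordinate functionals separate points: evaluating them at 1 gives back the
    coordinates. *)
Lemma embed_dual M : exists f : {linear M -> ffunm (kdim M) dualm}, injective f.
Proof.
pose b := vbasis {:kvec M}.
have eD : \dim {:kvec M} = kdim M by rewrite dimvf.
have L i : linear (fun x : kvec M => coord b i x : K^o) by move=> k x y; rewrite linearP.
pose f := @fftuple _ _ (kdim M) M dualm
  (fun i => hat (linfun (fun x : kvec M => coord b (cast_ord (esym eD) i) x : K^o))).
exists f; apply: lin_eq0_inj => x fx0.
rewrite [LHS](coord_vbasis (memvf (x : kvec M))) big1 // => i _.
have := congr1 (fun g : ffunm (kdim M) dualm => dual_fun (g (cast_ord eD i)) 1) fx0.
rewrite !ffunE hatE scale1r dual_fun0 cast_ordK.
by rewrite -[linfun _]/(linfun (mklin (L i))) lfunE /= => ->; rewrite scale0r.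
Qed.

Definition lmulT (c : A) (phi : dualm) : dualm := dual_of (fun x => dual_fun phi (x * c)).
Lemma lmulTE c phi x : dual_fun (lmulT c phi) x = dual_fun phi (x * c).
Proof. by apply: dual_ofE => k u v; rewrite mulrDl -scalerAl dual_funP. Qed.
Fact lmulT_linear c : linear (lmulT c).
Proof.
move=> a u v; apply: dual_ext => x; rewrite lmulTE !dual_funD !dual_funZ !lmulTE.
by rewrite mulrA.
Qed.
HB.instance Definition _ c := GRing.isLinear.Build A^c dualm dualm _ (lmulT c) (lmulT_linear c).

Lemma dual_sep (x : A) : (forall phi : dualm, dual_fun phi x = 0) -> x = 0.
Proof.
move=> H; apply/eqP; apply/negP => /negP /functional_nz[e /negP[]].
exact/eqP/(H e).
Qed.

Lemma lmulT_inj c d : (forall phi, lmulT c phi = lmulT d phi) -> c = d.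
Proof.
move=> H; apply/eqP; rewrite -subr_eq0; apply/eqP/dual_sep => phi.
have := congr1 (fun psi => dual_fun psi 1) (H phi); rewrite !lmulTE !mul1r => e.
by rewrite -scaleN1r addrC dual_funP e mulN1r addNr.
Qed.

Lemma dual_fun_sum (J : Type) (s : seq J) (F : J -> dualm) y :
  dual_fun (\sum_(i <- s) F i) y = \sum_(i <- s) dual_fun (F i) y.
Proof. by elim/big_rec2: _ => [|i a b _ <-]; rewrite ?dual_fun0 ?dual_funD. Qed.

(* The transpose of an A-endomorphism of T = DA is an endomorphism of A as a   *)
(* left module, that is, right multiplication by its value at 1.               *)
Lemma end_dual (u : {linear dualm -> dualm}) : exists c : A, forall phi, u phi = lmulT c phi.
Proof.
pose b := vbasis {:A}.
pose c : A := \sum_i (dual_fun (u (dual_of (coord b i))) 1) *: b`_i.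
exists c => phi; apply: dual_ext => x.
have L i : linear (coord b i : A -> K^o) by move=> k y z; rewrite linearP.
have bF : free b by exact: basis_free (vbasisP _).
have expand (psi : dualm) : psi = \sum_(i < \dim {:A})
    ((dual_fun psi b`_i)%:A : A^c) *: (dual_of (coord b i) : dualm).
  apply: dual_ext => y; apply: etrans (esym (dual_fun_sum _ _ _)).
  rewrite {1}(coord_vbasis (memvf y)) /dual_fun linear_sum; apply: eq_bigr => i _.
  rewrite linearZ -[RHS]/(dual_fun _ _) dual_funZ (dual_ofE (L i)).
  by rewrite -scalerAl mul1r linearZ /= mulrC.
have key (psi : dualm) : dual_fun (u psi) 1 = dual_fun psi c.
  rewrite {1}(expand psi) linear_sum; apply: etrans (dual_fun_sum _ _ _) _.
  rewrite /c [RHS]/dual_fun linear_sum.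
  apply: eq_bigr => i _; rewrite !linearZ dual_funZ -scalerAl mul1r.
  rewrite -[_ *: 1]addr0 dual_funP [X in _ + X = _]/dual_fun linear0 addr0.
  by rewrite mulrC; apply: etrans (addr0 _) _.
have := key ((x : A^c) *: phi); rewrite linearZ !dual_funZ mulr1 => ->.
by rewrite lmulTE.
Qed.

End Dual.

(** * The stable category *)

Section Stable.
Variables (K : fieldType) (A : falgType K).
Implicit Types M N X Y Z P Q E : fgmod A.

(** Stated for bare functions, so that expressions such as [fun x => v (u x) - x] need not be
    packaged as linear maps. *)
Definition stably_zero M N (f : M -> N) : Prop :=
  exists P (u : {linear M -> P}) (v : {linear P -> N}),
    projective_mod P /\ forall x, f x = v (u x).

Lemma stably_zero_ext M N (f g : M -> N) : (forall x, f x = g x) -> stably_zero f -> stably_zero g.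
Proof. by move=> e [P [u [v [pP fE]]]]; exists P, u, v; split=> // x; rewrite -e. Qed.

Lemma stably_zero_compl M N X (f : M -> N) (g : {linear N -> X}) :
  stably_zero f -> stably_zero (fun x => g (f x)).
Proof.
move=> [P [u [v [pP fE]]]]; exists P, u, (g \o v : {linear P -> X}).
by split => // x /=; rewrite fE.
Qed.

Lemma stably_zero_compr M N X (f : N -> X) (g : {linear M -> N}) :
  stably_zero f -> stably_zero (fun x => f (g x)).
Proof.
move=> [P [u [v [pP fE]]]]; exists P, (u \o g : {linear M -> P}), v.
by split => // x /=; rewrite fE.
Qed.

Lemma stably_zeroD M N (f g : M -> N) :
  stably_zero f -> stably_zero g -> stably_zero (fun x => f x + g x).
Proof.
move=> [P [u [v [pP fE]]]] [Q [u' [v' [pQ gE]]]].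
have uL : linear (fun x => (u x, u' x) : prodm P Q).
  by move=> a x y; congr (_, _); exact: linearP.
have vL : linear (fun z : prodm P Q => v z.1 + v' z.2).
  by move=> a x y; rewrite /= !linearP scalerDr addrACA.
exists (prodm P Q), (mklin uL), (mklin vL); split; first exact: prod_projective.
by move=> x; rewrite fE gE.
Qed.

Lemma stably_zeroN M N (f : M -> N) : stably_zero f -> stably_zero (fun x => - f x).
Proof.
move=> [P [u [v [pP fE]]]]; exists P, u, (\- v : {linear P -> N}).
by split => // x /=; rewrite fE.
Qed.

Lemma stably_zeroB M N (f g : M -> N) :
  stably_zero f -> stably_zero g -> stably_zero (fun x => f x - g x).
Proof. by move=> hf hg; apply: stably_zeroD => //; exact: stably_zeroN. Qed.

Lemma stably_zero_0 M N : stably_zero (fun _ : M => 0 : N).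
Proof.
exists (freem A 0), (\0 : {linear M -> freem A 0}), (\0 : {linear freem A 0 -> N}).
by split => //; exact: free_projective.
Qed.

Lemma stably_zero_sum M N k (f : 'I_k -> M -> N) : (forall i, stably_zero (f i)) ->
  stably_zero (fun x => \sum_i f i x).
Proof.
move=> hf; elim: (index_enum _) => [|i s IH].
  by apply: stably_zero_ext (@stably_zero_0 M N) => x; rewrite big_nil.
by apply: stably_zero_ext (stably_zeroD (hf i) IH) => x; rewrite big_cons.
Qed.

Lemma stably_zero_id_proj M : stably_zero (fun x : M => x) -> projective_mod M.
Proof.
move=> [P [u [v [pP E]]]]; apply: (@retract_projective _ _ P M u v) => //.
Qed.

Lemma stably_zero_lift M N E (f : M -> N) (p : {linear E -> N}) : surjective_lin p ->
  stably_zero f -> exists g : {linear M -> E}, forall x, p (g x) = f x.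
Proof.
move=> pS [P [u [v [pP fE]]]]; have [w wP] := pP E N p v pS.
by exists (w \o u : {linear M -> E}) => x; rewrite /= wP fE.
Qed.

Definition kmul M (k : K) (x : M) : M := (k%:A : A^c) *: x.
Fact kmul_linear M k : linear (@kmul M k).
Proof.
move=> a x y; rewrite /kmul scalerDr !scalerA; congr (_ *: _ + _).
by rewrite -[LHS]/((a : A) * k%:A) -[RHS]/((k%:A : A) * a) -scalerAr -scalerAl mulr1 mul1r.
Qed.
HB.instance Definition _ M k := GRing.isLinear.Build A^c M M _ (@kmul M k) (@kmul_linear M k).

Lemma lmulTM (x c : A) (phi : dualm A) : lmulT x (lmulT c phi) = lmulT (x * c) phi.
Proof. by apply: dual_ext => y; rewrite !lmulTE mulrA. Qed.

Lemma lmulT1 (phi : dualm A) : lmulT 1 phi = phi.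
Proof. by apply: dual_ext => y; rewrite lmulTE mulr1. Qed.

Lemma dual_funk (phi : dualA A) (k : K) x : dual_fun phi (k *: x) = k * dual_fun phi x.
Proof. by rewrite /dual_fun linearZ. Qed.

Lemma lmulT_kP (k : K) (c d : A) (phi : dualm A) :
  lmulT (k *: c + d) phi = kmul k (lmulT c phi) + lmulT d phi.
Proof.
apply: dual_ext => y; rewrite lmulTE dual_funD /kmul dual_funZ !lmulTE.
by rewrite -scalerAl mul1r -scalerAl mulrDr -scalerAr dual_funP dual_funk.
Qed.

Lemma lmulT0 (phi : dualm A) : lmulT 0 phi = 0.
Proof. by apply: dual_ext => y; rewrite lmulTE mulr0 dual_fun0 /dual_fun linear0. Qed.

Definition regv (x : regmod A) : A := x.

(* The endomorphisms T -> A -> T of T that factor through left multiplication  *)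
(* by an element of I, read in A = End(T).                                     *)
Definition gen_end (I : {vspace A}) (c : A) : Prop :=
  exists (t : dualm A) (a : A) (g : {linear dualm A -> regmod A}), a \in I /\
    forall x, lmulT c x = (a * regv (g x) : A^c) *: t.

Lemma regvZ (b : A^c) (x : regmod A) : regv (b *: x) = regv x * (b : A).
Proof. by []. Qed.
Lemma regvD (x y : regmod A) : regv (x + y) = regv x + regv y.
Proof. by []. Qed.

Lemma gen_end_exists (t : dualm A) (a : A) (g : {linear dualm A -> regmod A}) :
  exists c, forall x, lmulT c x = (a * regv (g x) : A^c) *: t.
Proof.
have L : linear (fun x => (a * regv (g x) : A^c) *: t).
  move=> b x y; rewrite linearP regvD regvZ scalerA -scalerDl; congr (_ *: t).
  by rewrite mulrDr mulrA.
by have [c cP] := end_dual (mklin L); exists c => x; rewrite -cP.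
Qed.

(** The span is the intersection of all subspaces containing the generators; the second clause
    serves as an induction principle in [pred_span]. *)
Lemma gen_span_exists (I : {vspace A}) : exists J : {vspace A},
  (forall c, gen_end I c -> c \in J) /\
  (forall J' : {vspace A}, (forall c, gen_end I c -> c \in J') -> (J <= J')%VS).
Proof.
have [||J JP] := @vspace_of_pred K A
   (fun c => forall J' : {vspace A}, (forall c, gen_end I c -> c \in J') -> c \in J').
- by move=> J' _; exact: mem0v.
- by move=> a u v hu hv J' hJ; rewrite memvD ?memvZ ?hu ?hv.
exists J; split; first by move=> c gc; apply/JP => J'; exact.
by move=> J' hJ; apply/subvP => c /JP; apply.
Qed.

Lemma pred_span (J : {vspace A}) (I : {vspace A}) (U : A -> Prop) :
  (forall J' : {vspace A}, (forall c, gen_end I c -> c \in J') -> (J <= J')%VS) ->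
  U 0 -> (forall (a : K) u v, U u -> U v -> U (a *: u + v)) ->
  (forall c, gen_end I c -> U c) -> forall c, c \in J -> U c.
Proof.
move=> JP U0 Ul gU c cJ; have [W WP] := vspace_of_pred U0 Ul.
by apply/WP; apply: (subvP (JP W _)) cJ => d /gU/WP.
Qed.

(** A embeds in a power of T = DA and, being injective, splits off; the sum is the retraction
    applied to the image of 1. *)
Lemma dual_generator : selfinjective A ->
  exists k (t : 'I_k -> dualm A) (g : 'I_k -> {linear dualm A -> regmod A}),
    \sum_i regv (g i (t i)) = 1.
Proof.
move=> hA; have [f fI] := embed_dual (regmod A).
have [g gP] := hA (regmod A) _ f (idfun : {linear regmod A -> regmod A}) fI.
exists (kdim (regmod A)), (fun i => f (1 : A) i).
exists (fun i => (g \o @ffin _ _ (kdim (regmod A)) (dualm A) i : {linear dualm A -> regmod A})).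
have e := gP (1 : A); rewrite [f _]ffin_sum linear_sum /= in e.
exact: e.
Qed.

Definition ideal (I : {vspace A}) := forall x c : A, c \in I -> x * c \in I /\ c * x \in I.

(** Let phi I be the ideal of A = End(T) spanned by the maps of [gen_end I]. As T is a generator, I
    is recoverable from phi I, so phi is injective on ideals. The descending chain phi^n A
    stabilises by dimension, and injectivity pulls the equality back to phi A = A. The identity of T
    is then a sum of maps factoring through A. *)
Lemma dual_projective : selfinjective A -> projective_mod (dualm A).
Proof.
move=> hA; have [k [t [g gt1]]] := dual_generator hA.
have [phi phiP] := choice gen_span_exists.
have phi_mono I I' : (I <= I')%VS -> (phi I <= phi I')%VS.
  move=> le; apply: (phiP I).2 => c [u [a [h [aI cE]]]].
  by apply: (phiP I').1; exists u, a, h; split=> //; exact: (subvP le).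
have phi_ideal I : ideal (phi I).
  move=> x c cI; split.
    apply: (pred_span (phiP I).2 _ _ _ cI (U := fun c => x * c \in phi I)).
    - by rewrite mulr0 mem0v.
    - by move=> a u v hu hv; rewrite mulrDr -scalerAr memvD ?memvZ.
    move=> d [u [a [h [aI dE]]]]; apply: (phiP I).1; exists (lmulT x u), a, h.
    by split => // y; rewrite -lmulTM dE linearZ.
  apply: (pred_span (phiP I).2 _ _ _ cI (U := fun c => c * x \in phi I)).
  - by rewrite mul0r mem0v.
  - by move=> a u v hu hv; rewrite mulrDl -scalerAl memvD ?memvZ.
  move=> d [u [a [h [aI dE]]]]; apply: (phiP I).1.
  exists u, a, (h \o @lmulT _ A x : {linear dualm A -> regmod A}).
  by split => // y; rewrite -lmulTM dE.
(* Every c in phi I satisfies g_i(c t_j) in I, and a is the sum of the elements g_i(t_i) a g_j(t_j)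
   over i and j. *)
have rec I : ideal I -> forall a, a \in I <-> (forall i j c,
    (forall x, lmulT c x = (a * regv (g j x) : A^c) *: t i) -> c \in phi I).
  move=> idI a; split.
    by move=> aI i j c cE; apply: (phiP I).1; exists (t i), a, (g j).
  move=> H.
  have out c : c \in phi I -> forall i j, regv (g i (lmulT c (t j))) \in I.
    move=> cI i j.
    apply: (pred_span (phiP I).2 _ _ _ cI (U := fun c => regv (g i (lmulT c (t j))) \in I)).
    - by rewrite lmulT0 linear0 mem0v.
    - move=> b u v hu hv; rewrite lmulT_kP linearD regvD memvD // linearZ regvZ.
      by rewrite -scalerAr mulr1 memvZ.
    move=> d [u [b [h [bI dE]]]]; rewrite dE linearZ regvZ.
    by apply: (idI _ _ _).1; apply: (idI _ _ _).2.
  have -> : a = \sum_i \sum_j regv (g i (t i)) * (a * regv (g j (t j))).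
    transitivity (\sum_i regv (g i (t i)) * a).
      by rewrite -mulr_suml gt1 mul1r.
    by apply: eq_bigr => i _; rewrite -mulr_sumr -mulr_sumr gt1 mulr1.
  rewrite memv_suml // => i _; rewrite memv_suml // => j _.
  have [c cE] := gen_end_exists (t i) a (g j).
  by have := out c (H i j c cE) i j; rewrite cE linearZ regvZ.
have phi_inj I I' : ideal I -> ideal I' -> phi I = phi I' -> I = I'.
  move=> hI hI' e; apply/vspaceP => a; apply/idP/idP => /rec H.
    by apply/rec => //; rewrite -e; exact: H.
  by apply/rec => //; rewrite e; exact: H.
pose J n := iter n phi fullv.
have Jid n : ideal (J n).
  by case: n => [|n]; [move=> x c _; rewrite !memvf | exact: phi_ideal].
have Jdec n : (J n.+1 <= J n)%VS.
  by elim: n => [|n IH]; [exact: subvf | exact: phi_mono].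
(* Injectivity of phi cancels one application at a time. *)
have Jeq n : J n.+1 = J n -> J 1%N = J 0%N.
  by elim: n => // n IH e; apply: IH; apply: (phi_inj (J n.+1) (J n)) => //.
have J10 : J 1%N = J 0%N.
  apply: contrapT => ne.
  (* Otherwise every inclusion is strict, and the dimension would drop by at least n after n steps
     for every n. *)
  have lt n : (\dim (J n) + n <= \dim (J 0%N))%N.
    elim: n => [|n IH]; first by rewrite addn0.
    rewrite addnS; apply: leq_trans IH; rewrite -addSn leq_add2r.
    rewrite (ltn_leqif (dimv_leqif_eq (Jdec n))).
    by apply/eqP => e; apply: ne; exact: Jeq e.
  have := lt (\dim (J 0%N)).+1.
  by rewrite leqNgt addnS ltnS leq_addl.
have id0 c : c \in phi fullv -> stably_zero (@lmulT _ A c : dualm A -> dualm A).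
  move=> cI; apply: (pred_span (phiP _).2 _ _ _ cI
    (U := fun c => stably_zero (@lmulT _ A c : dualm A -> dualm A))).
  - by apply: stably_zero_ext (@stably_zero_0 _ _) => x; rewrite lmulT0.
  - move=> a u v hu hv.
    apply: stably_zero_ext (stably_zeroD (stably_zero_compl (@kmul (dualm A) a) hu) hv) => x.
    by rewrite lmulT_kP.
  move=> d [u [a [h [_ dE]]]].
  exists (freem A 1), (fftuple (fun _ : 'I_1 => h)), (comb (fun _ => (a : A^c) *: u)).
  split; first exact: free_projective.
  by move=> x; rewrite dE combE big_ord1 ffunE scalerA.
apply: stably_zero_id_proj; apply: stably_zero_ext (id0 1 _) => [x|]; first by rewrite lmulT1.
by rewrite -[phi fullv]/(J 1%N) J10 memvf.
Qed.
End Stable.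

(** * Syzygies and Ext in the stable category *)

Record proj_cover (K : fieldType) (A : falgType K) (M : fgmod A) := ProjCover {
  cov_P : fgmod A;
  cov_Z : fgmod A;
  cov_i : {linear cov_Z -> cov_P};
  cov_p : {linear cov_P -> M};
  cov_ses : ses cov_i cov_p;
  cov_proj : projective_mod cov_P
}.
Arguments cov_i {K A M} _.
Arguments cov_p {K A M} _.
Arguments cov_ses {K A M} _.
Arguments cov_proj {K A M} _.

Section StableCategory.
Variables (K : fieldType) (A : falgType K).
Implicit Types M N X Y Z P Q E : fgmod A.

Section ResOfCover.
Variables (c : forall M, proj_cover M) (M : fgmod A).

Definition cov_syz i : fgmod A := iter i (fun N => cov_Z (c N)) M.
Definition cov_mod i : fgmod A := cov_P (c (cov_syz i)).
Definition cov_diff i : {linear cov_mod i.+1 -> cov_mod i} :=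
  (cov_i (c (cov_syz i)) \o cov_p (c (cov_syz i.+1)) : {linear cov_mod i.+1 -> cov_mod i}).

Lemma cov_exact i x :
  cov_p (c (cov_syz i)) x = 0 <-> exists y, cov_diff i y = x.
Proof.
have [_ _ ->] := cov_ses (c (cov_syz i)); have [_ pS _] := cov_ses (c (cov_syz i.+1)).
split=> [[z <-]|[y <-]]; last by exists (cov_p (c (cov_syz i.+1)) y).
by have [y yz] := pS z; exists y; rewrite /cov_diff /= -yz.
Qed.

Fact cov_aug_surj : surjective_lin (cov_p (c (cov_syz 0))).
Proof. by have [_ pS _] := cov_ses (c (cov_syz 0)). Qed.

Fact cov_diff_exact i x : cov_diff i x = 0 <-> exists y, cov_diff i.+1 y = x.
Proof.
have [iI _ _] := cov_ses (c (cov_syz i)).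
split=> [e|/cov_exact e]; last by rewrite /cov_diff /= e linear0.
by apply/cov_exact; apply: iI; rewrite linear0.
Qed.

Definition res_of_cover : proj_res M :=
  @ProjRes _ _ M cov_mod cov_diff (cov_p (c (cov_syz 0)))
   (fun i => cov_proj (c (cov_syz i))) cov_aug_surj (@cov_exact 0) cov_diff_exact.
End ResOfCover.

Lemma free_cover_ses M : exists Z (i : {linear Z -> freem A (kdim M)})
  (p : {linear freem A (kdim M) -> M}), ses i p.
Proof.
by have [p pS] := free_cover M; have [Z [i ip]] := ses_ker pS; exists Z, i, p.
Qed.

Lemma proj_res_exists M : exists P : proj_res M, True.
Proof.
have H N : exists c : proj_cover N, True.
  have [Z [i [p ip]]] := free_cover_ses N.
  by exists (ProjCover ip (@free_projective _ _ _)).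
by exists (res_of_cover (fun N => sval (cid (H N))) M).
Qed.

(** One choice of syzygy, not a minimal one, fixed through the free cover of rank [kdim M]; this
    makes syzygies definite modules of controlled dimension. *)
Definition free_syz M : fgmod A := sval (cid (free_cover_ses M)).
Lemma free_syz_ses M : exists (i : {linear free_syz M -> freem A (kdim M)})
  (p : {linear freem A (kdim M) -> M}), ses i p.
Proof. exact: svalP (cid (free_cover_ses M)). Qed.

Definition syzygy i M : fgmod A := iter i free_syz M.

Lemma kdim_free_syz M : (kdim (free_syz M) <= kdim M * kdim (regmod A))%N.
Proof.
have [i [p [iI _ _]]] := free_syz_ses M.
by rewrite -kdim_ffun; exact: kdim_inj iI.
Qed.

Definition stable_hom0 M N : Prop := forall f : {linear M -> N}, stably_zero f.

Definition stably_iso M N : Prop := exists (u : {linear M -> N}) (v : {linear N -> M}),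
  stably_zero (fun x => v (u x) - x) /\ stably_zero (fun y => u (v y) - y).

Lemma stably_iso_refl M : stably_iso M M.
Proof.
by exists idfun, idfun; split; apply: stably_zero_ext (@stably_zero_0 _ _ M M) => x; rewrite subrr.
Qed.

Lemma stably_iso_sym M N : stably_iso M N -> stably_iso N M.
Proof. by move=> [u [v [h1 h2]]]; exists v, u. Qed.

Lemma stable_hom0_stably_iso M M' N : stably_iso M M' -> stable_hom0 M N -> stable_hom0 M' N.
Proof.
move=> [u [v [_ h]]] H f.
have fuv := stably_zero_compr v (H (f \o u : {linear M -> N})).
apply: stably_zero_ext (stably_zeroB fuv (stably_zero_compl f h)) => x.
by rewrite /= linearB opprB addrC subrK.
Qed.

Hypothesis hA : selfinjective A.

Lemma dual_embed_free : exists k (s : {linear dualm A -> freem A k})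
  (r : {linear freem A k -> dualm A}), forall x, r (s x) = x.
Proof.
have [p pS] := free_cover (dualm A).
have [s sP] := dual_projective hA (idfun : {linear dualm A -> dualm A}) pS.
by exists (kdim (dualm A)), s, p.
Qed.

(** M embeds in a power of T by [embed_dual], and T, being projective, is a summand of a free
    module. *)
Lemma embed_free M : exists k (f : {linear M -> freem A k}), injective f.
Proof.
have [k [s [r rs]]] := dual_embed_free; have [e eI] := embed_dual M.
pose T : finType := ('I_(kdim M) * 'I_k)%type.
exists #|T|, (fftuple (fun z : 'I_#|T| =>
  (@ffproj _ _ k (regmod A) (enum_val z).2 \o
     (s \o (@ffproj _ _ (kdim M) (dualm A) (enum_val z).1 \o e)) : {linear M -> regmod A}))).
apply: lin_eq0_inj => x x0; apply: eI; rewrite linear0; apply/ffunP => i.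
rewrite -[LHS]rs ffunE -[RHS](linear0 r); congr (r _); apply/ffunP => j.
have := congr1 (fun y : freem A #|T| => y (enum_rank (i, j))) x0.
by rewrite !ffunE /= enum_rankK.
Qed.

(** Projectives are injective: they are summands of powers of A. *)
Lemma proj_extend P M N (j : {linear M -> N}) (f : {linear M -> P}) :
  projective_mod P -> injective j -> exists g : {linear N -> P}, forall x, g (j x) = f x.
Proof.
move=> pP jI; have [p pS] := free_cover P.
have [s sP] := pP _ _ p (idfun : {linear P -> P}) pS.
have H i := hA (@ffproj _ _ _ (regmod A) i \o (s \o f) : {linear M -> regmod A}) jI.
have [g gP] := choice H.
exists (p \o fftuple g : {linear N -> P}) => x; rewrite /= -[RHS]sP; congr (p _).
by apply/ffunP => i; rewrite ffunE gP.
Qed.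

Lemma stably_zero_extend M N E (f : M -> N) (j : {linear M -> E}) : injective j ->
  stably_zero f -> exists g : {linear E -> N}, forall x, g (j x) = f x.
Proof.
move=> jI [P [u [v [pP fE]]]]; have [w wP] := proj_extend u pP jI.
by exists (v \o w : {linear E -> N}) => x; rewrite /= wP fE.
Qed.

Section Ladder.
Variables (Z P N Z' P' N' : fgmod A).
Variables (i : {linear Z -> P}) (p : {linear P -> N}).
Variables (i' : {linear Z' -> P'}) (p' : {linear P' -> N'}).
Hypotheses (ip : ses i p) (ip' : ses i' p') (pP : projective_mod P)
  (pP' : projective_mod P').

Lemma ladder_l (a : {linear Z -> Z'}) :
  exists (b : {linear P -> P'}) (c : {linear N -> N'}),
    (forall x, b (i x) = i' (a x)) /\ (forall x, c (p x) = p' (b x)).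
Proof.
have [iI pS ker] := ip; have [iI' pS' ker'] := ip'.
have [b bP] := proj_extend (i' \o a : {linear Z -> P'}) pP' iI.
have [|c cP] := @lin_fact_surj _ _ _ _ _ p (p' \o b : {linear P -> N'}) pS.
  by move=> x /ker[z <-]; rewrite /= bP /= (ses_comp0 _ ip').
by exists b, c; split => x; [exact: bP | exact: cP].
Qed.

Lemma ladder_r (c : {linear N -> N'}) :
  exists (a : {linear Z -> Z'}) (b : {linear P -> P'}),
    (forall x, b (i x) = i' (a x)) /\ (forall x, c (p x) = p' (b x)).
Proof.
have [iI pS ker] := ip; have [iI' pS' ker'] := ip'.
have [b bP] := pP (c \o p : {linear P -> N'}) pS'.
have [|a aP] := @lin_fact_inj _ _ _ _ _ i' (b \o i : {linear Z -> P'}) iI'.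
  by move=> x; apply/ker'; rewrite /= bP /= (ses_comp0 _ ip) linear0.
by exists a, b; split => x; [exact: (esym (aP x)) | exact: (esym (bP x))].
Qed.

(** Together with [ladder_l] and [ladder_r], this makes Omega fully faithful on stable maps. If [a]
    is stably zero it extends along [i], and [b] minus this extension descends to a lift of [c]
    through [p']; the converse is dual. *)
Lemma ladder_stably_zero (a : {linear Z -> Z'}) (b : {linear P -> P'}) (c : {linear N -> N'}) :
  (forall x, b (i x) = i' (a x)) -> (forall x, c (p x) = p' (b x)) ->
  stably_zero a <-> stably_zero c.
Proof.
have [iI pS ker] := ip; have [iI' pS' ker'] := ip'.
move=> ab bc; split => [a0|c0].
  have [a' aP] := stably_zero_extend iI a0.
  have [|s sP] := @lin_fact_surj _ _ _ _ _ p (b \- (i' \o a') : {linear P -> P'}) pS.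
    by move=> x /ker[z <-]; rewrite /= aP ab subrr.
  exists P', s, p'; split => // y; have [x <-] := pS y.
  by rewrite bc sP /= linearB (ses_comp0 _ ip') subr0.
have [s sP] := stably_zero_lift pS' c0.
have [|t tP] := @lin_fact_inj _ _ _ _ _ i' (b \- (s \o p) : {linear P -> P'}) iI'.
  by move=> x; apply/ker'; rewrite /= linearB sP bc subrr.
exists P, i, t; split => // z; apply: iI'.
by rewrite tP /= ab (ses_comp0 _ ip) linear0 subr0.
Qed.

Lemma stable_hom0_syz : stable_hom0 N N' -> stable_hom0 Z Z'.
Proof.
by move=> H a; have [b [c [ab bc]]] := ladder_l a; apply/(ladder_stably_zero ab bc).
Qed.
End Ladder.

(** Stable form of Schanuel's lemma. *)
Lemma stably_iso_syz Z P N Z' P' N' (i : {linear Z -> P}) (p : {linear P -> N})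
    (i' : {linear Z' -> P'}) (p' : {linear P' -> N'}) :
  ses i p -> ses i' p' -> projective_mod P -> projective_mod P' ->
  stably_iso N N' -> stably_iso Z Z'.
Proof.
move=> ip ip' pP pP' [u [v [vu uv]]].
have [a [b [ab bu]]] := ladder_r ip ip' pP u.
have [a' [b' [ab' bv]]] := ladder_r ip' ip pP' v.
exists a, a'; split.
  apply/(ladder_stably_zero ip ip pP pP (a := (a' \o a) \- idfun : {linear Z -> Z})
    (b := (b' \o b) \- idfun : {linear P -> P})
    (c := (v \o u) \- idfun : {linear N -> N})) => //= x.
    by rewrite linearB /= ab ab'.
  by rewrite linearB /= bu bv.
apply/(ladder_stably_zero ip' ip' pP' pP' (a := (a \o a') \- idfun : {linear Z' -> Z'})
  (b := (b \o b') \- idfun : {linear P' -> P'})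
  (c := (u \o v) \- idfun : {linear N' -> N'})) => //= x.
  by rewrite linearB /= ab' ab.
by rewrite linearB /= bv bu.
Qed.

(** Connects an arbitrary projective resolution, over which Ext is defined, with the fixed free
    syzygies. *)
Lemma proj_res_image M (P : proj_res M) i :
  exists Z (q : {linear P i.+1 -> Z}) (j : {linear Z -> P i}),
    [/\ surjective_lin q, injective j, forall x, j (q x) = pr_diff P i x
      & stably_iso Z (syzygy i.+1 M)].
Proof.
have step j N (p : {linear P j -> N}) : surjective_lin p ->
    (forall x, p x = 0 <-> exists y, pr_diff P j y = x) -> stably_iso N (syzygy j M) ->
    exists Z (q : {linear P j.+1 -> Z}) (l : {linear Z -> P j}),
    [/\ surjective_lin q, injective l, forall x, l (q x) = pr_diff P j x
      & stably_iso Z (syzygy j.+1 M)].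
  move=> pS pE st; have [Z [q [l [qS lI lq]]]] := im_exists (pr_diff P j).
  exists Z, q, l; split => //.
  have [i0 [p0 s0]] := free_syz_ses (syzygy j M).
  have s1 : ses l p.
    split; [exact: lI | exact: pS | move=> x]; rewrite pE; split.
      by move=> [y <-]; exists (q y); rewrite lq.
    by move=> [z <-]; have [y <-] := qS z; exists y; rewrite lq.
  exact: (stably_iso_syz s1 s0 (@pr_projective _ _ _ P j) (@free_projective _ _ _) st).
elim: i => [|i [Z [q [l [qS lI lq st]]]]].
  apply: (step 0%N M (pr_aug P)); [exact: pr_aug_surj | exact: pr_aug_exact|].
  exact: stably_iso_refl.
apply: (step i.+1 Z q) => // x; rewrite -pr_diff_exact -lq.
by split => [->|]; [rewrite linear0 | rewrite -[0](linear0 l) => /lI].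
Qed.

(** A cocycle of degree i+1 is a map on the image of the differential into [P i], and a coboundary
    is one that extends to [P i]. As projectives are injective, extending is the same as factoring
    through a projective. *)
Lemma Ext_stable_hom0 i M N : Ext_eq0 i.+1 M N <-> stable_hom0 (syzygy i.+1 M) N.
Proof.
split => [H|H P f fc].
  have [P _] := proj_res_exists M.
  have [Z [q [j [qS jI jq st]]]] := proj_res_image P i.
  apply: stable_hom0_stably_iso st _ => f.
  have fc : cocycle (f \o q : {linear P i.+1 -> N}).
    move=> x /=; have -> : q (pr_diff P i.+1 x) = 0; last by rewrite linear0.
    by apply: jI; rewrite jq linear0; apply/pr_diff_exact; exists x.
  have [g gP] := H P _ fc.
  exists (P i), j, g; split; first exact: (@pr_projective _ _ _ P i).
  by move=> z; have [x <-] := qS z; rewrite jq -gP.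
have [Z [q [j [qS jI jq st]]]] := proj_res_image P i.
have [|f' fE] := @lin_fact_surj _ _ _ _ _ q f qS.
  move=> x qx; have /pr_diff_exact[y <-] : pr_diff P i x = 0 by rewrite -jq qx linear0.
  exact: fc.
have [g gP] := stably_zero_extend jI (stable_hom0_stably_iso (stably_iso_sym st) H f').
by exists g => x; rewrite -jq gP fE.
Qed.

End StableCategory.

(** * The inverse Nakayama functor and Auslander-Reiten duality *)

Section Nakayama.
Variables (K : fieldType) (A : falgType K).
Implicit Types M N X Y Z P Q E W : fgmod A.

Lemma lmulTD (x y : A) (t : dualm A) : lmulT (x + y) t = lmulT x t + lmulT y t.
Proof. by rewrite -{1}[x]scale1r lmulT_kP /kmul !scale1r. Qed.

(* Gmod M below is Hom_A(DA, M), with the action of A coming from its left     *)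
(* action on DA.                                                               *)
Record homT M := HomT { homT_fun :> dualm A -> M; homT_linear : linear homT_fun }.

Lemma homT_ext M (f g : homT M) : (forall t, f t = g t) -> f = g.
Proof.
case: f g => f fL [g gL] /= /funext e; move: gL; rewrite -e => gL.
by congr HomT; exact: Prop_irrelevance.
Qed.

HB.instance Definition _ M := gen_eqMixin (homT M).
HB.instance Definition _ M := gen_choiceMixin (homT M).

Definition homT_of M (f : {linear dualm A -> M}) : homT M := HomT (linearP f).
Definition homT_map M (f : homT M) : {linear dualm A -> M} := mklin (homT_linear f).

Section HomTModule.
Variable M : fgmod A.
Definition homT0 : homT M := homT_of (\0 : {linear dualm A -> M}).
Definition homTN (f : homT M) : homT M := homT_of (\- homT_map f : {linear dualm A -> M}).
Definition homTD (f g : homT M) : homT M :=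
  homT_of (homT_map f \+ homT_map g : {linear dualm A -> M}).
Definition homTZ (a : A^c) (f : homT M) : homT M :=
  homT_of (homT_map f \o @lmulT K A a : {linear dualm A -> M}).

Fact homTDA : associative homTD.
Proof. by move=> f g h; apply: homT_ext => t /=; rewrite addrA. Qed.
Fact homTDC : commutative homTD.
Proof. by move=> f g; apply: homT_ext => t /=; rewrite addrC. Qed.
Fact homT0D : left_id homT0 homTD.
Proof. by move=> f; apply: homT_ext => t /=; rewrite add0r. Qed.
Fact homTND : left_inverse homT0 homTN homTD.
Proof. by move=> f; apply: homT_ext => t /=; rewrite addNr. Qed.
HB.instance Definition _ := GRing.isZmodule.Build (homT M) homTDA homTDC homT0D homTND.

Fact homTZA a b v : homTZ a (homTZ b v) = homTZ (a * b) v.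
Proof. by apply: homT_ext => t /=; rewrite lmulTM. Qed.
Fact homTZ1 : left_id 1 homTZ.
Proof. by move=> f; apply: homT_ext => t /=; rewrite lmulT1. Qed.
Fact homTZDr : right_distributive homTZ +%R.
Proof. by move=> a f g; apply: homT_ext. Qed.
Fact homTZDl v : {morph homTZ^~ v : a b / a + b}.
Proof.
move=> a b; apply: homT_ext => t /=.
have -> : lmulT (a + b : A) t = lmulT a t + lmulT b t by exact: lmulTD.
exact: (linearD (homT_map v)).
Qed.
HB.instance Definition _ := GRing.Zmodule_isLmodule.Build A^c (homT M)
  homTZA homTZ1 homTZDr homTZDl.

Lemma lmulT_k (k : K) (t : dualm A) : lmulT (k%:A) t = (k%:A : A^c) *: t.
Proof.
apply: dual_ext => x; rewrite lmulTE dual_funZ; congr (dual_fun _ _).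
by rewrite -scalerAl -scalerAr mul1r mulr1.
Qed.

Lemma fin_gen_homT : fin_gen (homT M).
Proof.
apply: (@fin_gen_inj K A (homT M) 'Hom(kvec (dualm A), kvec M)
   (fun f => linfun (klin (homT_map f)))).
- by move=> f g; apply/lfunP => t; rewrite add_lfunE !lfunE.
- move=> k f; apply/lfunP => t; rewrite scale_lfunE !lfunE kscaleE.
  rewrite -[LHS]/(homT_map f (lmulT k%:A t)) lmulT_k.
  by rewrite linearZ.
move=> f g e; apply: homT_ext => t.
have : linfun (klin (homT_map f)) t = linfun (klin (homT_map g)) t by rewrite e.
by rewrite !lfunE.
Qed.
Definition Gmod : fgmod A := FGMod fin_gen_homT.
End HomTModule.

Lemma GmodD M (f g : Gmod M) t : homT_fun (f + g) t = homT_fun f t + homT_fun g t.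
Proof. by []. Qed.
Lemma GmodZ M (a : A^c) (f : Gmod M) t : homT_fun (a *: f) t = homT_fun f (lmulT a t).
Proof. by []. Qed.
Lemma Gmod0 M t : homT_fun (0 : Gmod M) t = 0.
Proof. by []. Qed.

Definition Gfun M N (f : {linear M -> N}) (u : Gmod M) : Gmod N :=
  homT_of (f \o homT_map u : {linear dualm A -> N}).
Fact Gfun_linear M N (f : {linear M -> N}) : linear (Gfun f).
Proof. by move=> a u v; apply: homT_ext => t; rewrite /= !linearD. Qed.
Definition Gmap M N (f : {linear M -> N}) : {linear Gmod M -> Gmod N} :=
  mklin (Gfun_linear f).

Lemma GmapE M N (f : {linear M -> N}) u t : homT_fun (Gmap f u) t = f (homT_fun u t).
Proof. by []. Qed.

Lemma Gmap_inj M N (f : {linear M -> N}) : injective f -> injective (Gmap f).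
Proof.
move=> fI u v e; apply: homT_ext => t; apply: fI.
by rewrite -!GmapE e.
Qed.

Hypothesis hA : selfinjective A.

Lemma Gmap_surj M N (f : {linear M -> N}) : surjective_lin f -> surjective_lin (Gmap f).
Proof.
move=> fS v; have [u uP] := dual_projective hA (homT_map v) fS.
by exists (homT_of u); apply: homT_ext => t; rewrite GmapE /= uP.
Qed.

Lemma Gmap_ses Z P N (i : {linear Z -> P}) (p : {linear P -> N}) :
  ses i p -> ses (Gmap i) (Gmap p).
Proof.
case=> iI pS ker; split; [exact: Gmap_inj | exact: Gmap_surj | move=> u].
split=> [e|[v <-]]; last first.
  by apply: homT_ext => t; rewrite !GmapE Gmod0; apply/ker; exists (v t).
have [|v vP] := @lin_fact_inj _ _ _ _ _ i (homT_map u) iI.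
  by move=> t; apply/ker; have := congr1 (fun h : Gmod N => homT_fun h t) e; rewrite GmapE.
by exists (homT_of v); apply: homT_ext => t; rewrite GmapE /= vP.
Qed.

(** The composite T -> A -> M of [g] with a |-> y a. Since T is a generator, such maps reach every
    element of M. *)
Definition evT M (y : M) (g : {linear dualm A -> regmod A}) (x : dualm A) : M :=
  (regv (g x) : A^c) *: y.
Fact evT_linear M (y : M) (g : {linear dualm A -> regmod A}) : linear (evT y g).
Proof.
move=> b u v; rewrite /evT linearP regvD regvZ scalerA -scalerDl.
by congr (_ *: y).
Qed.
Definition evG M (y : M) g : Gmod M := HomT (evT_linear y g).

Lemma G_generate : exists k (t : 'I_k -> dualm A) (g : 'I_k -> {linear dualm A -> regmod A}),
  \sum_i regv (g i (t i)) = 1 /\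
  forall M (y : M), y = \sum_i homT_fun (evG y (g i)) (t i).
Proof.
have [k [t [g gt]]] := dual_generator hA; exists k, t, g; split => // M y.
rewrite /= /evT -scaler_suml; transitivity ((1 : A^c) *: y); first by rewrite scale1r.
by congr (_ *: y); exact: esym gt.
Qed.

Lemma G_faithful M N (f g : {linear M -> N}) :
  (forall u, Gmap f u = Gmap g u) -> forall y, f y = g y.
Proof.
have [k [t [h [_ gen]]]] := G_generate => e y.
rewrite (gen M y) !linear_sum; apply: eq_bigr => i _.
by rewrite -!GmapE e.
Qed.

(** The candidate sends y to the sum of F(ev_{y,h_i})(t_i). For y = u(x), the map ev_{y,h_i} is u
    composed with s |-> x h_i(s), an endomorphism of T and hence an element of A; linearity of F
    over A then gives f(u(x)) = F(u)(x). *)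
Lemma G_full M N (F : {linear Gmod M -> Gmod N}) :
  exists f : {linear M -> N}, forall u, Gmap f u = F u.
Proof.
have [k [t [h [ht gen]]]] := G_generate.
pose f (y : M) : N := \sum_i homT_fun (F (evG y (h i))) (t i).
have fu (u : Gmod M) x : f (homT_fun u x) = homT_fun (F u) x.
  have E i : homT_fun (F (evG (homT_fun u x) (h i))) (t i) =
      homT_fun (F u) ((regv (h i (t i)) : A^c) *: x).
    have L : linear (fun s : dualm A => (regv (h i s) : A^c) *: x).
      by move=> b r s; rewrite linearP regvD regvZ scalerA -scalerDl; congr (_ *: x).
    have [c cE] := end_dual (mklin L).
    have -> : evG (homT_fun u x) (h i) = (c : A^c) *: u.
      apply: homT_ext => s; rewrite GmodZ -cE /= /evT.
      by rewrite -[RHS]/(homT_map u _) linearZ.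
    by rewrite linearZ GmodZ -cE.
  rewrite /f (eq_bigr _ (fun i _ => E i)).
  have e1 : x = \sum_i (regv (h i (t i)) : A^c) *: x.
    rewrite -scaler_suml; transitivity ((1 : A^c) *: x); first by rewrite scale1r.
    by congr (_ *: x); exact: esym ht.
  by rewrite -[RHS]/(homT_map (F u) x) [in RHS]e1 linear_sum.
have fD y z : f (y + z) = f y + f z.
  rewrite /f -big_split; apply: eq_bigr => i _ /=.
  have -> : evG (y + z) (h i) = evG y (h i) + evG z (h i) :> Gmod M.
    by apply: homT_ext => s; rewrite /= /evT scalerDr.
  by rewrite linearD.
have f0 : f 0 = 0 by apply: (addrI (f 0)); rewrite -fD !addr0.
have f_sum n (w : 'I_n -> M) : f (\sum_i w i) = \sum_i f (w i).
  by elim/big_rec2: _ => // i a b _ <-; rewrite fD.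
have fL : linear f.
  move=> a y z; rewrite fD; congr (_ + _).
  rewrite (gen M y) scaler_sumr !f_sum scaler_sumr; apply: eq_bigr => i _.
  have GZ X (u : Gmod X) r : a *: homT_fun u r = homT_fun u (a *: r).
    by rewrite -[RHS]/(homT_map u _) linearZ.
  by rewrite GZ !fu GZ.
by exists (mklin fL) => u; apply: homT_ext => x; rewrite GmapE /= fu.
Qed.

Lemma ffun_projective k P : projective_mod P -> projective_mod (ffunm k P).
Proof.
move=> pP M N p f pS.
have [g gP] := choice (fun i => pP M N p (f \o @ffin _ _ k P i : {linear P -> N}) pS).
exists (ffcotuple g) => x.
rewrite [in RHS](ffin_sum x) !linear_sum; apply: eq_bigr => i _; exact: gP.
Qed.

(** P is injective, hence a summand of a power of T, and G T = End(T) = A. *)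
Lemma G_projective P : projective_mod P -> projective_mod (Gmod P).
Proof.
move=> pP; have [s sI] := embed_dual P.
have [r rs] := proj_extend hA (idfun : {linear P -> P}) pP sI.
have cP (u : Gmod P) : exists c : freem A (kdim P), forall l t,
    s (homT_fun u t) l = lmulT (regv (c l)) t.
  have [c cE] := choice (fun l => end_dual (@ffproj _ _ _ (dualm A) l \o (s \o homT_map u)
     : {linear dualm A -> dualm A})).
  by exists [ffun l => c l : regmod A] => l t; rewrite ffunE -cE.
have [c cE] := choice cP.
have cL : linear c.
  move=> a u v; apply/ffunP => l; apply: lmulT_inj => t.
  transitivity (s (homT_fun (a *: u + v) t) l); first by rewrite cE.
  rewrite GmodD GmodZ linearD !ffunE !cE lmulTM -lmulTD.
  by congr (lmulT _ t).
pose m l : Gmod P := homT_of (r \o @ffin _ _ _ (dualm A) l : {linear dualm A -> P}).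
apply: (@retract_projective _ _ _ _ (mklin cL) (comb m)); last exact: free_projective.
move=> u; apply: homT_ext => t; rewrite combE.
have GS n (F : 'I_n -> Gmod P) : homT_fun (\sum_i F i) t = \sum_i homT_fun (F i) t.
  by elim/big_rec2: _ => // i x y _ <-.
rewrite GS -[RHS]rs [in RHS](ffin_sum (s _)) linear_sum; apply: eq_bigr => l _ /=.
by rewrite cE.
Qed.

Lemma G_reflect_stably_zero M N (f : {linear M -> N}) : stably_zero (Gmap f) -> stably_zero f.
Proof.
move=> Gf; have [q qS] := free_cover N.
have [a aP] := stably_zero_lift (Gmap_surj qS) Gf.
have [b bP] := G_full a.
exists (freem A (kdim N)), b, q; split; first exact: free_projective.
apply: (G_faithful (g := q \o b : {linear M -> N})) => u.
by rewrite -aP -bP; apply: homT_ext.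
Qed.

End Nakayama.

(** * The Nakayama functor on submodules of free modules *)

Section NakayamaObject.
Variables (K : fieldType) (A : falgType K).
Implicit Types M N X Y Z P Q E W : fgmod A.
Hypothesis hA : selfinjective A.

Lemma dual_fun_sumr (t : dualm A) n (f : 'I_n -> A) :
  dual_fun t (\sum_l f l) = \sum_l dual_fun t (f l).
Proof. by rewrite /dual_fun linear_sum. Qed.

Lemma dual_funr0 (t : dualm A) : dual_fun t 0 = 0.
Proof. by rewrite /dual_fun linear0. Qed.

Definition annih W k (i : {linear W -> freem A k}) (x : 'I_k -> A) : Prop :=
  forall w, \sum_l x l * regv (i w l) = 0.

(** If c were outside W, some functional would kill W but not c. Its adjoint A^k -> T does the same,
    and so does a coordinate of it once T is embedded in a free module; that coordinate is left
    multiplication by a row in W^perp. *)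
Lemma double_annih W k (i : {linear W -> freem A k}) (c : freem A k) :
  (forall x, annih i x -> \sum_l x l * regv (c l) = 0) -> exists w, i w = c.
Proof.
move=> H; apply: contrapT => cW.
have [||I IP] := @vspace_of_pred K (kvec (freem A k)) (fun y => exists w, i w = y).
- by exists 0; rewrite linear0.
- by move=> a _ _ [u <-] [v <-]; exists ((a%:A : A^c) *: u + v); rewrite linearP.
have [|eta [eta0 etac]] := @functional_exists K (kvec (freem A k)) I c.
  by apply/negP => /IP.
have [n [s [r rs]]] := dual_embed_free hA.
have hW w : hat eta (i w) = 0.
  apply: dual_ext => a; rewrite hatE dual_fun0; apply: eta0; apply/IP.
  by exists ((a : A^c) *: w); rewrite linearZ.
have [j sj] : exists j, s (hat eta c) j != 0.
  apply: contrapT => /forallNP sj; case/negP: etac.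
  have sc0 : s (hat eta c) = 0.
    by apply/ffunP => j; rewrite ffunE; have /negP := sj j; rewrite negbK => /eqP.
  have := congr1 (fun phi => dual_fun phi 1) (rs (hat eta c)).
  by rewrite sc0 linear0 dual_fun0 hatE scale1r => <-.
pose h : {linear freem A k -> regmod A} := (@ffproj _ _ n (regmod A) j \o (s \o hat eta)).
have hE y : regv (h y) = \sum_l regv (h (freeb A l)) * regv (y l).
  by rewrite (lin_freeE h).
case/eqP: sj; rewrite -[LHS]/(regv (h c)) hE; apply: H => w.
by rewrite -hE /h /= hW linear0 /ffproj ffunE.
Qed.

(* Y = nu W is the annihilator in T^k = D(A^k) of the left module W^perp =      *)
(* Hom_A(A^k / W, A). For h : M -> Y, regarded as a functional on M^k, vanishing *)
(* of the stable maps N -> M makes h vanish on the solutions of the equations   *)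
(* given by generators of W; so h is a combination of these equations, which   *)
(* factors it through a power of the projective module T.                      *)
Lemma nakayama_exists k W (i : {linear W -> freem A k}) : injective i ->
  exists Y, [/\ (kdim Y <= k * kdim (dualm A))%N,
    exists theta : {linear W -> Gmod Y}, bijective theta &
    forall N (p : {linear freem A k -> N}), ses i p ->
      forall M, stable_hom0 N M -> stable_hom0 M Y].
Proof.
move=> iI.
have [||Y [j [jI jP]]] := @submod_of_pred K A (ffunm k (dualm A))
    (fun phi => forall x, annih i x -> \sum_l dual_fun (phi l) (x l) = 0).
- by move=> x _; rewrite big1 // => l _; rewrite ffunE dual_fun0.
- move=> a u v hu hv x ax.
  rewrite (eq_bigr (fun l => dual_fun (u l) ((a : A) * x l) + dual_fun (v l) (x l))).
    rewrite big_split /= (hv x ax) addr0; apply: hu => w.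
    transitivity ((a : A) * \sum_l x l * regv (i w l)); last by rewrite ax mulr0.
    by rewrite mulr_sumr; apply: eq_bigr => l _; rewrite mulrA.
  by move=> l _; rewrite !ffunE dual_funD dual_funZ.
exists Y; split; first by rewrite -kdim_ffun; exact: kdim_inj jI.
  (* [theta] sends w to t |-> (w_l t)_l, which lies in Y because rows of W^perp kill w. *)
  have thP (w : W) : exists u : Gmod Y, forall t l, j (homT_fun u t) l = lmulT (regv (i w l)) t.
    have [|u uP] := @lin_fact_inj _ _ _ _ _ j
        (fftuple (fun l => @lmulT K A (regv (i w l)) : {linear dualm A -> dualm A})) jI.
      move=> t; apply/jP => x ax; rewrite (eq_bigr (fun l => dual_fun t (x l * regv (i w l)))).
        by rewrite -dual_fun_sumr ax dual_funr0.
      by move=> l _; rewrite ffunE lmulTE.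
    by exists (homT_of u) => t l; rewrite /= uP ffunE.
  have [th thE] := choice thP.
  have thL : linear th.
    move=> a u v; apply: homT_ext => t; apply: jI; apply/ffunP => l.
    rewrite thE GmodD GmodZ [in RHS]linearD [RHS]ffunE !thE lmulTM -lmulTD.
    rewrite linearP !ffunE.
    by congr (lmulT _ t).
  exists (mklin thL); apply: inj_surj_bij.
    move=> u v /= e; apply: iI; apply/ffunP => l; apply: lmulT_inj => t.
    by rewrite -!thE e.
  move=> u.
  (* The coordinates of u : T -> T^k are elements c_l of A. Their tuple is killed by W^perp, so it
     lies in W. *)
  have [c cE] := choice (fun l => end_dual (@ffproj _ _ _ (dualm A) l \o (j \o homT_map u)
     : {linear dualm A -> dualm A})).
  have [|w wE] := @double_annih W k i [ffun l => c l : regmod A].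
    move=> x ax; apply: dual_sep => t.
    have /jP/(_ _ ax) : exists y, j y = j (homT_fun u t) by exists (homT_fun u t).
    rewrite dual_fun_sumr => {2}<-; apply: eq_bigr => l _.
    have -> : j (homT_fun u t) l = lmulT (c l) t := cE l t.
    by rewrite lmulTE ffunE.
  exists w; apply: homT_ext => t; apply: jI; apply/ffunP => l.
  by rewrite thE wE ffunE -cE.
move=> N p [_ pS ker] M NM h.
pose etaf (m : kvec (ffunm k M)) : K^o := \sum_l dual_fun (j (h (m l)) l) 1.
have hk (a : K) (m1 m2 : M) l x : dual_fun (j (h ((a%:A : A^c) *: m1 + m2)) l) x =
    a * dual_fun (j (h m1) l) x + dual_fun (j (h m2) l) x.
  rewrite !linearP !ffunE dual_funD dual_funZ; congr (_ + _).
  by rewrite -scalerAl mul1r dual_funk.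
have etaL : linear etaf.
  move=> a m1 m2; rewrite /etaf scaler_sumr -big_split; apply: eq_bigr => l _.
  by rewrite !ffunE; exact: hk.
have [d [w wP]] := fgmod_fin_gen W.
(* The equations given by the generators [w] of W: the solutions of [Bf m = 0] are the tuples that
   define a map from N = A^k / W to M. *)
pose Bf (m : kvec (ffunm k M)) : kvec (ffunm d M) :=
  [ffun b => \sum_l (i (w b) l : A^c) *: (m l : M)] : ffunm d M.
have BL : linear Bf.
  move=> a m1 m2; rewrite kscaleE; apply/ffunP => b; rewrite !ffunE scaler_sumr -big_split.
  apply: eq_bigr => l _; rewrite !ffunE scalerDr !scalerA; congr (_ *: _ + _).
  by rewrite -[LHS]/((a%:A : A) * (i (w b) l : A)) -[RHS]/((i (w b) l : A) * a%:A)
    -scalerAl -scalerAr mul1r mulr1.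
have [e2 e2P] := free_cover M.
have kerB m : Bf m = 0 -> etaf m = 0.
  move=> m0; have cm x : p x = 0 -> comb (m : 'I_k -> M) x = 0.
    move=> /ker[z <-]; have [a ->] := wP z; rewrite !linear_sum big1 // => b _.
    have e : \sum_l (i (w b) l : A^c) *: (m l : M) = 0 :> M.
      by have := congr1 (fun y : ffunm d M => y b) m0; rewrite !ffunE.
    have -> : comb (m : 'I_k -> M) (i (a b *: w b)) = a b *: comb (m : 'I_k -> M) (i (w b)).
      by rewrite !linearZ.
    by rewrite combE e scaler0.
  have [f fP] := @lin_fact_surj _ _ _ _ _ p (comb (m : 'I_k -> M)) pS cm.
  have [g gP] := stably_zero_lift e2P (NM f).
  (* The matrix of the lift of [f] to a free module. Its rows lie in W^perp, so they pair to zero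
     with the values of [h] in Y. *)
  pose x r l : A := regv (g (p (freeb A l)) r).
  have ax r : annih i (x r).
    move=> z; have : regv (g (p (i z)) r) = 0.
      have -> : p (i z) = 0 by apply/ker; exists z.
      by rewrite linear0 ffunE.
    have := lin_freeE
      (@ffproj _ _ _ (regmod A) r \o (g \o p) : {linear freem A k -> regmod A}) (i z).
    by move=> /= e; rewrite -[g (p (i z)) r]/(ffproj r (g (p (i z)))) e.
  have mE l : m l = \sum_r (x r l : A^c) *: e2 (freeb A r).
    by rewrite -(comb_freeb (m : 'I_k -> M)) -fP -gP (lin_freeE e2).
  have e2E r l : dual_fun (j (h ((x r l : A^c) *: e2 (freeb A r))) l) 1 =
      dual_fun (j (h (e2 (freeb A r))) l) (x r l).
    by rewrite !linearZ ffunE dual_funZ mulr1.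
  transitivity (\sum_l \sum_r dual_fun (j (h (e2 (freeb A r))) l) (x r l)).
    apply: eq_bigr => l _; rewrite mE !linear_sum sum_ffunE.
    by apply: etrans (dual_fun_sum _ _ _) _; apply: eq_bigr => r _; exact: e2E.
  rewrite exchange_big big1 // => r _.
  have /jP : exists y, j y = j (h (e2 (freeb A r))) by exists (h (e2 (freeb A r))).
  by apply; exact: ax.
pose eta := linfun (mklin etaL); pose B := linfun (mklin BL).
(* [B^-1] picks preimages on the image of [B]; by [kerB] the functional does not depend on the
   pick. *)
pose th := (eta \o B^-1)%VF.
have thB m : th (Bf m) = etaf m.
  have : etaf (m - (B^-1)%VF (B m)) = 0.
    apply: kerB; rewrite -[LHS]/(mklin BL _) linearB -[X in _ - X]lfunE.
    rewrite limg_lfunVK ?subrr //; first by rewrite lfunE subrr.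
    by rewrite memv_img ?memvf.
  rewrite -[LHS]/(mklin etaL _) linearB => /eqP; rewrite subr_eq0 => /eqP.
  rewrite -[mklin etaL m]/(etaf m) => ->; rewrite comp_lfunE lfunE.
  by rewrite [B m]lfunE.
have thi b : linear (fun m : kvec M => th (@ffin _ _ d M b m)).
  move=> a m1 m2.
  have -> : @ffin _ _ d M b (a *: m1 + m2) =
     (a *: (@ffin _ _ d M b m1 : kvec (ffunm d M)) + @ffin _ _ d M b m2 : kvec (ffunm d M)).
    exact: linearP.
  exact: linearP.
pose thb b := linfun (mklin (thi b)).
have thS m : th m = \sum_b thb b (m b).
  rewrite {1}[m]ffin_sum linear_sum; apply: eq_bigr => b _.
  by rewrite lfunE.
have uP b : exists u : {linear dualm A -> Y},
    forall t l, j (u t) l = lmulT (regv (i (w b) l)) t.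
  have [|u uP] := @lin_fact_inj _ _ _ _ _ j
      (fftuple (fun l => @lmulT K A (regv (i (w b) l)) : {linear dualm A -> dualm A})) jI.
    move=> t; apply/jP => x ax; rewrite (eq_bigr (fun l => dual_fun t (x l * regv (i (w b) l)))).
      by rewrite -dual_fun_sumr ax dual_funr0.
    by move=> l _; rewrite ffunE lmulTE.
  by exists u => t l; rewrite uP ffunE.
have [u uE] := choice uP.
(* The functional [th] on M^d has d components; their adjoints give M -> T^d, and the maps [u] lead
   from T^d to Y. *)
exists (ffunm d (dualm A)), (fftuple (fun b => hat (thb b) : {linear M -> dualm A})), (ffcotuple u).
split; first by apply: ffun_projective; exact: dual_projective.
move=> m; apply: jI; apply/ffunP => l; apply: dual_ext => x.
have -> : dual_fun (j (h m) l) x = dual_fun (j (h ((x : A^c) *: m)) l) 1.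
  by rewrite !linearZ ffunE dual_funZ mulr1.
have -> : dual_fun (j (h ((x : A^c) *: m)) l) 1 = etaf (@ffin _ _ k M l ((x : A^c) *: m)).
  rewrite /etaf (bigD1 l) //= ffunE eqxx big1 ?addr0 // => l' ne.
  by rewrite ffunE (negPf ne) !linear0 ffunE dual_fun0.
rewrite -thB thS linear_sum sum_ffunE; apply: etrans (esym (dual_fun_sum _ _ _)).
apply: eq_bigr => b _; rewrite uE lmulTE [fftuple _ _ _]ffunE hatE /Bf ffunE; congr (thb b _).
rewrite (bigD1 l) //= ffunE eqxx big1 ?addr0.
  by rewrite scalerA; congr (_ *: m).
by move=> l' ne; rewrite ffunE (negPf ne) scaler0.
Qed.

End NakayamaObject.

(** * Length and partial resolutions *)

Section Length.
Variables (K : fieldType) (A : falgType K).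
Implicit Types M N X Y Z P Q E W U V : fgmod A.

(** Composition length at most C, phrased by proper submodules only, so that it transports along the
    equivalence G. *)
Fixpoint len_le (C : nat) M : Prop :=
  match C with
  | 0 => forall x : M, x = 0
  | C'.+1 => forall W (j : {linear W -> M}),
      injective j -> ~ surjective_lin j -> len_le C' W
  end.

Lemma len_le_inj C W M (j : {linear W -> M}) : injective j -> len_le C M -> len_le C W.
Proof.
case: C => [|C] jI /= H; first by move=> x; apply: jI; rewrite linear0.
move=> V l lI lS; apply: (H V (j \o l : {linear V -> M})).
  by move=> x y /= /jI/lI.
by move=> S; apply: lS => y; have [x /= /jI <-] := S (j y); exists x.
Qed.

Lemma len_leS C M : len_le C M -> len_le C.+1 M.
Proof.
elim: C M => [|C IH] M H W j jI jS; first by move=> x; apply: jI; rewrite linear0 (H (j x)).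
by apply: IH; exact: H jS.
Qed.

Lemma len_le_mono C D M : (C <= D)%N -> len_le C M -> len_le D M.
Proof.
move=> /subnK <-; elim: (D - C)%N => // k IH H; rewrite addSn; apply: len_leS.
exact: IH.
Qed.

Lemma len_le_kdim C M : (kdim M <= C)%N -> len_le C M.
Proof.
elim: C M => [|C IH] M; first by rewrite leqn0 => /eqP; exact: kdim_eq0.
move=> le W j jI jS; apply: IH; rewrite -ltnS; apply: leq_trans le.
by rewrite ltnNge; apply/negP => /(kdim_inj_bij jI).
Qed.

Lemma kdim_zero M : (forall x : M, x = 0) -> kdim M = 0%N.
Proof.
move=> M0; apply/eqP; rewrite -leqn0 -(mul0n (kdim (regmod A))) -kdim_ffun.
apply: (@kdim_inj _ _ _ _ (\0 : {linear M -> freem A 0})).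
by move=> x y _; rewrite (M0 x) (M0 y).
Qed.

(** Take a proper submodule W of largest dimension and x outside it: then W + xA = M, so each unit
    of length costs at most dim A. *)
Lemma kdim_len_le C M : len_le C M -> (kdim M <= C * kdim (regmod A))%N.
Proof.
elim: C M => [|C IH] M H; first by rewrite kdim_zero.
have [M0|M0] := pselect (forall x : M, x = 0); first by rewrite kdim_zero.
pose S d := `[< exists W (j : {linear W -> M}),
   [/\ injective j, ~ surjective_lin j & kdim W = d] >].
have exS : exists d, S d.
  exists (kdim (freem A 0)); apply/asboolP; exists (freem A 0), (\0 : {linear freem A 0 -> M}).
  split => //; first by move=> x y _; apply/ffunP => -[].
  by move=> s; apply: M0 => y; have [x <-] := s y.
have ubS d : S d -> (d <= kdim M)%N by move=> /asboolP[W [j [jI _ <-]]]; exact: kdim_inj jI.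
case: (ex_maxnP exS ubS) => d /asboolP[W [j [jI jS dW]]] dmax.
have /existsNP[x xW] := jS.
have L : linear (fun z : prodm W (regmod A) => j z.1 + (regv z.2 : A^c) *: x).
  move=> a u v; rewrite /= linearP regvD regvZ scalerDl scalerDr scalerA addrACA.
  by [].
have [I [q [i [qS iI iq]]]] := im_exists (mklin L).
have iS : surjective_lin i.
  apply: contrapT => niS.
  have [|l lP] := @lin_fact_inj _ _ _ _ _ i j iI.
    move=> w; exists (q (w, 0)); rewrite iq /= -[regv _]/(0 : A^c) scale0r addr0 //.
  have lI : injective l by move=> u v e; apply: jI; rewrite -!lP e.
  have lS : surjective_lin l.
    apply: (kdim_inj_bij lI); rewrite dW; apply: dmax; apply/asboolP.
    by exists I, i.
  apply: xW; have [w wE] := lS (q (0, (1 : A))).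
  by exists w; rewrite -lP wE iq /= linear0 add0r -[regv _]/(1 : A^c) scale1r.
have le1 := kdim_surj iS; have le2 := kdim_surj qS.
apply: leq_trans le1 (leq_trans le2 _); rewrite kdim_prod mulSn addnC leq_add2l.
by apply: IH; exact: H jI jS.
Qed.

(** A proper submodule of E meets U in a proper submodule or has a proper image in V; one of the two
    bounds drops. *)
Lemma len_le_ext a b U E V (i : {linear U -> E}) (p : {linear E -> V}) :
  ses i p -> len_le a U -> len_le b V -> len_le (a + b) E.
Proof.
move En: (a + b)%N => n; elim: n a b En U E V i p => [|n IH] a b En U E V i p [iI pS ker] lU lV.
  move: En => /eqP; rewrite addn_eq0 => /andP[/eqP a0 /eqP b0].
  move: lU lV; rewrite a0 b0 /= => U0 V0 x.
  have /ker[u <-] : p x = 0 by exact: V0.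
  by rewrite (U0 u) linear0.
move=> W j jI jS.
have [V' [q [l [qS lI lq]]]] := im_exists (p \o j : {linear W -> V}).
have [U' [k kS]] := ses_ker qS; have [kI _ kk] := kS.
have [|t tP] := @lin_fact_inj _ _ _ _ _ i (j \o k : {linear U' -> E}) iI.
  by move=> u /=; apply/ker; have := lq (k u); rewrite /= (ses_comp0 _ kS) linear0.
have tI : injective t by move=> x y e; apply: kI; apply: jI; rewrite -[RHS]tP -e tP.
have [tS|tS] := pselect (surjective_lin t); last first.
  case: a lU En => [U0|a lU [En]].
    by case: tS => y; exists 0; rewrite linear0 (U0 y).
  by apply: (IH a b En _ _ _ k q) => //; [exact: (lU U' t tI tS) | exact: len_le_inj lI lV].
case: b lV En => [V0 _|b lV].
  case: jS => y; have /ker[u uE] : p y = 0 by exact: V0.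
  by have [u' u'E] := tS u; exists (k u'); rewrite -uE -u'E tP.
rewrite addnS => -[En]; apply: (IH a b En _ _ _ k q) => //.
  exact: len_le_inj tI lU.
apply: (lV _ l lI) => lS; apply: jS => y.
have [v vE] := lS (p y); have [w wE] := qS v.
have /ker[u uE] : p (y - j w) = 0 by rewrite linearB -vE -wE lq subrr.
have [u' u'E] := tS u; exists (k u' + w).
by rewrite linearD -[j (k u')]tP u'E uE subrK.
Qed.

Lemma ses_prod P Q : exists (i : {linear P -> prodm P Q}) (p : {linear prodm P Q -> Q}),
  ses i p /\ (forall x, i x = (x, 0)) /\ (forall z, p z = z.2).
Proof.
have iL : linear (fun x : P => (x, 0) : prodm P Q).
  move=> a x y; have e : (0 : Q) = a *: 0 + 0 by rewrite scaler0 addr0.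
  by congr (_, _).
have pL : linear (fun z : prodm P Q => z.2) by [].
exists (mklin iL), (mklin pL); split => //; split.
- by move=> x y [].
- by move=> y; exists (0, y).
- move=> [x y]; split => /= [->|[z [_ <-]]] //.
  by exists x.
Qed.

Lemma len_le_prod a b P Q : len_le a P -> len_le b Q -> len_le (a + b) (prodm P Q).
Proof. by have [i [p [ip _]]] := ses_prod P Q; exact: len_le_ext ip. Qed.

(* The first term has its own bound a because adding a projective summand to M *)
(* enlarges that term only: otherwise the bound would grow at each turn of the *)
(* induction in bound_stably_local.                                            *)
Fixpoint part_res (a C m : nat) M : Prop :=
  match m with
  | 0 => True
  | m'.+1 => exists Z P (i : {linear Z -> P}) (p : {linear P -> M}),
      [/\ ses i p, projective_mod P, len_le a P & part_res C C m' Z]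
  end.

Lemma part_res_mono a C b D m M : (a <= b)%N -> (C <= D)%N ->
  part_res a C m M -> part_res b D m M.
Proof.
elim: m a b M => // m IH a b M ab CD [Z [P [i [p [ip pP lP rZ]]]]].
exists Z, P, i, p; split => //; first exact: len_le_mono lP.
exact: IH rZ.
Qed.

Lemma part_res_down a C m M : part_res a C m.+1 M -> part_res a C m M.
Proof.
elim: m a M => // m IH a M [Z [P [i [p [ip pP lP rZ]]]]].
by exists Z, P, i, p; split => //; exact: IH.
Qed.

Lemma part_res_iso a C m M N (f : {linear M -> N}) : bijective f ->
  part_res a C m M -> part_res a C m N.
Proof.
case: m => // m [g fK gK] [Z [P [i [p [[iI pS ker] pP lP rZ]]]]].
exists Z, P, i, (f \o p : {linear P -> N}); split => //; split => //.
  by move=> y; have [x xE] := pS (g y); exists x; rewrite /= xE gK.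
move=> x; rewrite -ker /=; split => [e|->]; last by rewrite linear0.
by apply: (can_inj fK); rewrite e linear0.
Qed.

(** Horseshoe lemma, with the lengths of the terms added. *)
Lemma part_res_ext a b C D m U E V (i : {linear U -> E}) (p : {linear E -> V}) :
  ses i p -> part_res a C m U -> part_res b D m V -> part_res (a + b) (C + D) m E.
Proof.
elim: m a b U E V i p => // m IH a b U E V i p [iI pS ker].
move=> [Z [P [i1 [p1 [s1 pP lP rZ]]]]] [Y [Q [i2 [p2 [s2 pQ lQ rY]]]]].
have [iI1 pS1 ker1] := s1; have [iI2 pS2 ker2] := s2.
have [t tP] := pQ _ _ p p2 pS.
have fL : linear (fun z : prodm P Q => i (p1 z.1) + t z.2).
  by move=> c x y; rewrite /= !linearP scalerDr addrACA.
have fS : surjective_lin (mklin fL).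
  move=> e; have [y yE] := pS2 (p e).
  have /ker[u uE] : p (e - t y) = 0 by rewrite linearB tP yE subrr.
  have [x xE] := pS1 u; exists (x, y).
  by rewrite /= xE uE subrK.
have [W [k kS]] := ses_ker fS; have [kI _ kker] := kS.
exists W, (prodm P Q), k, (mklin fL).
have rK : part_res (C + D) (C + D) m W; last first.
  by split => //; [exact: prod_projective | exact: len_le_prod].
have [i3 [p3 [s3 [i3E p3E]]]] := ses_prod P Q.
have [|al alP] := @lin_fact_inj _ _ _ _ _ k (i3 \o i1 : {linear Z -> prodm P Q}) kI.
  by move=> z; apply/kker; rewrite /= i3E /= (ses_comp0 _ s1) !linear0 addr0.
have [|be beP] := @lin_fact_inj _ _ _ _ _ i2 (p3 \o k : {linear W -> Q}) iI2.
  move=> w; apply/ker2; rewrite /= p3E -tP.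
  have := congr1 p (ses_comp0 w kS).
  have pi u : p (i u) = 0 by apply/ker; exists u.
  by rewrite /= linearD pi add0r linear0.
apply: (IH C D Z W Y al be) => //; split.
- by move=> x y e; apply: iI1; have := alP x; rewrite e alP /= !i3E => -[].
- move=> y; have /ker[u uE] : p (t (i2 y)) = 0 by rewrite tP (ses_comp0 _ s2).
  have [x xE] := pS1 u.
  have /kker[w wE] : mklin fL (- x, i2 y) = 0 by rewrite /= !linearN xE uE addNr.
  by exists w; apply: iI2; rewrite beP /= p3E wE.
- move=> w; split => [e|[z <-]]; last first.
    by apply: iI2; rewrite beP /= alP /= p3E i3E linear0.
  have e2 : (k w).2 = 0 by rewrite -p3E -[LHS]beP e linear0.
  have e1 : p1 (k w).1 = 0.
    by apply: iI; have := ses_comp0 w kS; rewrite /= e2 !linear0 addr0.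
  have [z zE] := (ker1 _).1 e1; exists z; apply: kI; rewrite alP /= i3E zE -e2.
  by case: (k w).
Qed.

(** The projective complement Q joins the first term and leaves the kernel [Z] unchanged. *)
Lemma part_res_retract a c C m M N Q (s : {linear N -> M}) (r : {linear M -> N})
    (i : {linear Q -> M}) :
  (forall x, r (s x) = x) -> ses i r -> projective_mod Q -> len_le c Q ->
  part_res a C m N -> part_res (a + c) C m M.
Proof.
case: m => // m rs ir pQ lQ [Z [P [l [p [lp pP lP rZ]]]]].
have [iI _ ker] := ir; have [lI pS lker] := lp.
have fL : linear (fun z : prodm P Q => s (p z.1) + i z.2).
  by move=> b x y; rewrite /= !linearP scalerDr addrACA.
have [i3 [p3 [s3 [i3E p3E]]]] := ses_prod P Q.
exists Z, (prodm P Q), (i3 \o l : {linear Z -> prodm P Q}), (mklin fL); split => //.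
- split.
  + by move=> x y /=; rewrite !i3E => -[/lI].
  + move=> y; have [x xE] := pS (r y).
    have /ker[z zE] : r (y - s (r y)) = 0 by rewrite linearB rs subrr.
    by exists (x, z); rewrite /= xE zE addrC subrK.
  + move=> [x y] /=; split=> [e|[z]]; last first.
      by rewrite i3E => -[<- <-]; rewrite (ses_comp0 _ lp) !linear0 addr0.
    have e1 : p x = 0.
      by have := congr1 r e; rewrite linearD rs (ses_comp0 _ ir) linear0 addr0.
    have y0 : y = 0 by apply: iI; move: e; rewrite e1 !linear0 add0r.
    by have [z zE] := (lker _).1 e1; exists z; rewrite i3E zE y0.
- exact: prod_projective.
- exact: len_le_prod.
Qed.

(** For P -> X with kernel Z, the kernel of the composite P -> X -> M is an extension of N by Z, to
    which the horseshoe lemma applies. *)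
Lemma part_res_quot C D m M N X (i : {linear N -> X}) (p : {linear X -> M}) :
  ses i p -> part_res C C m N -> part_res D D m.+1 X ->
  part_res (C + D) (C + D) m.+1 M.
Proof.
move=> ip rN [Z [P [l [q [lq pP lP rZ]]]]].
have [iI pS ker] := ip; have [lI qS lker] := lq.
have fS : surjective_lin (p \o q : {linear P -> M}).
  by move=> y; have [x <-] := pS y; have [z <-] := qS x; exists z.
have [W [k kS]] := ses_ker fS; have [kI _ kker] := kS.
exists W, P, k, (p \o q : {linear P -> M}); split => //.
  by apply: len_le_mono lP; exact: leq_addl.
have [|al alP] := @lin_fact_inj _ _ _ _ _ k l kI.
  by move=> z; apply/kker; rewrite /= (ses_comp0 _ lq) linear0.
have [|be beP] := @lin_fact_inj _ _ _ _ _ i (q \o k : {linear W -> X}) iI.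
  by move=> w; apply/ker; exact: ses_comp0 kS.
rewrite addnC; apply: (@part_res_ext D C D C m Z W N al be) => //; split.
- by move=> x y e; apply: lI; rewrite -alP e alP.
- move=> y; have [x xE] := qS (i y).
  have /kker[w wE] : (p \o q : {linear P -> M}) x = 0 by rewrite /= xE (ses_comp0 _ ip).
  by exists w; apply: iI; rewrite beP /= wE.
- move=> w; split=> [e|[z <-]]; last first.
    by apply: iI; rewrite beP /= alP (ses_comp0 _ lq) linear0.
  have [z zE] : exists z, l z = k w by apply/lker; rewrite -[LHS]beP e linear0.
  by exists z; apply: kI; rewrite alP.
Qed.

Hypothesis hA : selfinjective A.

(** A submodule W of G M embeds in a free module, so W = G N by [nakayama_exists]. Its inclusion is
    G f by fullness, where f is injective and not surjective. *)
Lemma len_le_G C M : len_le C M -> len_le C (Gmod M).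
Proof.
elim: C M => [|C IH] M H; first by move=> u; apply: homT_ext => t; rewrite (H (u t)).
move=> W j jI jS.
have [k [i iI]] := embed_free hA W.
have [N [_ [th thB] _]] := nakayama_exists hA iI.
have [th' [thK th'K]] := lin_inv thB.
have [f fE] := G_full hA (j \o th' : {linear Gmod N -> Gmod M}).
have [n [t [g [_ gen]]]] := G_generate hA.
apply: (@len_le_inj C W (Gmod N) th (can_inj thK)); apply: IH; apply: (H N f).
  apply: lin_eq0_inj => y fy.
  have u0 l : evG y (g l) = 0 :> Gmod N.
    apply: (can_inj th'K); apply: jI; rewrite !linear0 -[LHS]fE.
    by apply: homT_ext => x; rewrite GmapE /= /evT linearZ /= fy scaler0.
  by rewrite (gen N y) big1 // => l _; rewrite u0.
move=> fS; apply: jS => v; have [u uE] := Gmap_surj hA fS v.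
by exists (th' u); rewrite -uE fE.
Qed.

Lemma part_res_G a C m M : part_res a C m M -> part_res a C m (Gmod M).
Proof.
elim: m a M => // m IH a M [Z [P [i [p [ip pP lP rZ]]]]].
exists (Gmod Z), (Gmod P), (Gmap i), (Gmap p); split.
- exact: Gmap_ses.
- exact: G_projective.
- exact: len_le_G.
- exact: IH.
Qed.

End Length.

(** * Modules with local stable endomorphism ring *)

Section Local.
Variables (K : fieldType) (A : falgType K).
Implicit Types M N X Y Z P Q E W U V I J L : fgmod A.

Fixpoint lin_iter M (f : {linear M -> M}) n : {linear M -> M} :=
  if n is n'.+1 then f \o lin_iter f n' : {linear M -> M} else idfun.

Lemma lin_iterE M (f : {linear M -> M}) n x : lin_iter f n x = iter n f x.
Proof. by elim: n => //= n ->. Qed.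

(* Fitting's lemma: q \o i is the map induced by f^(n+1) on its image I. *)
Lemma fitting M (f : {linear M -> M}) :
  exists n I (q : {linear M -> I}) (i : {linear I -> M}) (g' : {linear I -> I}),
    [/\ surjective_lin q, injective i, forall x, i (q x) = iter n.+1 f x
      & (forall x, g' (q (i x)) = x)].
Proof.
pose S d := `[< exists n I (q : {linear M -> I}) (i : {linear I -> M}),
  [/\ surjective_lin q, injective i, forall x, i (q x) = iter n.+1 f x & kdim I = d] >].
have exS : exists d, S d.
  have [I [q [i [qS iI iq]]]] := im_exists f.
  by exists (kdim I); apply/asboolP; exists 0%N, I, q, i.
case: (ex_minnP exS) => d /asboolP[n [I [q [i [qS iI iq dI]]]]] dmin.
have [J [q' [i' [qS' iI' iq']]]] := im_exists (q \o i : {linear I -> I}).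
have leIJ : (kdim I <= kdim J)%N.
  rewrite dI; apply: dmin; apply/asboolP.
  (* The exponent is (n+1+n)+1 = 2(n+1): J is the image of the square of f^(n+1). *)
  exists (n.+1 + n)%N, J, (q' \o q : {linear M -> J}), (i \o i' : {linear J -> M}).
  split => //.
  - by move=> y; have [x <-] := qS' y; have [z <-] := qS x; exists z.
  - by move=> x y /iI/iI'.
  - move=> x; transitivity (i (q (i (q x)))); first by congr (i _); exact: iq'.
    by rewrite iq iq -iterD addnS.
have gS : surjective_lin (q \o i : {linear I -> I}).
  move=> y; have [j <-] := kdim_inj_bij iI' leIJ y; have [x <-] := qS' j.
  by exists x; rewrite iq'.
have gI := kdim_surj_bij gS (leqnn _).
have [g' [gK _]] := lin_inv (inj_surj_bij gI gS).
by exists n, I, q, i, g'; split.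
Qed.

Definition no_proj_summand M : Prop :=
  forall N (s : {linear N -> M}) (r : {linear M -> N}),
    (forall x, r (s x) = x) -> projective_mod N -> forall x : N, x = 0.

Lemma stably_zero_iter M (f : {linear M -> M}) n : stably_zero f -> stably_zero (iter n.+1 f).
Proof.
elim: n => [//|n IH] f0.
exact: (stably_zero_compl f (IH f0)).
Qed.

(** The Fitting image of f is a summand whose identity factors through a power of f; it is therefore
    projective, hence zero. *)
Lemma no_proj_nilp M (f : {linear M -> M}) : no_proj_summand M -> stably_zero f ->
  exists n, forall x, iter n f x = 0.
Proof.
move=> np f0; have [n [I [q [i [g' [qS iI iq gK]]]]]] := fitting f.
have I0 : forall x : I, x = 0.
  apply: (np I i (g' \o q : {linear M -> I}) gK).
  apply: stably_zero_id_proj.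
  have h := stably_zero_compr i
    (stably_zero_compl (g' \o (g' \o q) : {linear M -> I}) (stably_zero_iter n f0)).
  by apply: stably_zero_ext h => x; rewrite -iq /= !gK.
by exists n.+1 => x; rewrite -iq (I0 (q x)) linear0.
Qed.

(** w s - 1 is nilpotent, yet acts as -1 on the kernel of s. *)
Lemma no_proj_inj M X (s : {linear M -> X}) (w : {linear X -> M}) :
  no_proj_summand M -> stably_zero (fun x => w (s x) - x) -> injective s.
Proof.
move=> np h.
have h' : stably_zero ((w \o s) \- idfun : {linear M -> M}) by [].
have [n nE] := no_proj_nilp np h'.
apply: lin_eq0_inj => x sx.
have e m : exists k : bool, iter m ((w \o s) \- idfun) x = (-1) ^+ k *: x.
  elim: m => [|m [k IH]]; first by exists false; rewrite scale1r.
  exists (~~ k); rewrite iterS IH.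
  have -> : ((w \o s) \- idfun : {linear M -> M}) ((-1) ^+ k *: x) =
      (-1) ^+ k *: (((w \o s) \- idfun : {linear M -> M}) x) by rewrite linearZ.
  by rewrite /= sx linear0 sub0r scalerN -scaleNr; case: k {IH}; rewrite ?expr0 ?expr1 ?opprK.
have [k] := e n; rewrite nE => /esym.
by case: k; rewrite ?expr0 ?expr1 ?scaleN1r ?scale1r // => /eqP; rewrite oppr_eq0 => /eqP.
Qed.

Lemma no_proj_zero M : no_proj_summand M -> stably_zero (fun x : M => x) -> forall x : M, x = 0.
Proof. by move=> np /stably_zero_id_proj pM; exact: (np M idfun idfun). Qed.

(** Take a retract of least dimension among those stably isomorphic to M; splitting off a nonzero
    projective would give a smaller one. *)
Lemma no_proj_retract M : exists N (s : {linear N -> M}) (r : {linear M -> N}),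
  [/\ forall x, r (s x) = x, stably_zero (fun x => s (r x) - x) & no_proj_summand N].
Proof.
pose S d := `[< exists N (s : {linear N -> M}) (r : {linear M -> N}),
  [/\ forall x, r (s x) = x, stably_zero (fun x => s (r x) - x) & kdim N = d] >].
have exS : exists d, S d.
  exists (kdim M); apply/asboolP; exists M, idfun, idfun; split => //.
  by apply: stably_zero_ext (@stably_zero_0 _ _ M M) => x /=; rewrite subrr.
case: (ex_minnP exS) => d /asboolP[N [s [r [rs sr dN]]]] dmin.
exists N, s, r; split => // L s0 r0 rs0 pL.
have [Q [i [q [iS qi iq]]]] := ker_ses_split rs0; have [iI _ ker] := iS.
have dQ : (kdim N <= kdim Q)%N.
  rewrite dN; apply: dmin; apply/asboolP.
  exists Q, (s \o i : {linear Q -> M}), (q \o r : {linear M -> Q}); split => //.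
    by move=> x; rewrite /= rs qi.
  have h : stably_zero (fun x : M => s (s0 (r0 (r x)))).
    exists L, (r0 \o r : {linear M -> L}), (s \o s0 : {linear L -> M}); by split.
  apply: stably_zero_ext (stably_zeroB sr h) => x; rewrite /= iq linearB.
  by rewrite addrAC.
have iSurj := kdim_inj_bij iI dQ.
move=> x; have [z zE] := iSurj (s0 x).
by rewrite -(rs0 x) -zE (ses_comp0 _ iS).
Qed.

Definition stably_local M : Prop := forall f g : {linear M -> M},
  stably_zero (fun x => f x + g x - x) ->
  (exists w : {linear M -> M}, stably_zero (fun x => w (f x) - x)) \/
  (exists w : {linear M -> M}, stably_zero (fun x => w (g x) - x)).

Lemma stably_local_stably_iso M N : stably_iso M N -> stably_local M -> stably_local N.
Proof.
move=> [u [v [vu uv]]] lM f g fg.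
have tr (h w : {linear _ -> _}) : stably_zero (fun x : M => w (v (h (u x))) - x) ->
    exists w' : {linear N -> N}, stably_zero (fun y => w' (h y) - y).
  move=> H; exists (u \o (w \o v) : {linear N -> N}).
  have H1 := stably_zero_compr v (stably_zero_compl u H).
  have H2 := stably_zero_compl (u \o (w \o (v \o h)) : {linear N -> N}) uv.
  apply: stably_zero_ext (stably_zeroB (stably_zeroD H1 uv) H2) => y.
  have zm (a b c d : N) : a - b + (b - d) - (a - c) = c - d.
    by rewrite (addrA (a - b)) (subrK b a) opprB [a - d + _]addrC (addrA (c - a)) subrK.
  pose a := u (w (v (h (u (v y))))).
  transitivity (a - u (v y) + (u (v y) - y) - (a - u (w (v (h y))))); last exact: zm.
  by rewrite linearB /= !linearB.
have H : stably_zero (fun x => v (f (u x)) + v (g (u x)) - x).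
  apply: stably_zero_ext (stably_zeroD (stably_zero_compr u (stably_zero_compl v fg)) vu) => x /=.
  by rewrite linearB linearD addrA subrK.
have [[w wP]|[w wP]] := lM (v \o (f \o u) : {linear M -> M}) (v \o (g \o u) : {linear M -> M}) H.
  by left; exact: tr wP.
by right; exact: tr wP.
Qed.

Lemma stably_iso_bij M N (f : {linear M -> N}) : bijective f -> stably_iso M N.
Proof.
move=> /lin_inv[g [fK gK]]; exists f, g; split.
  by apply: stably_zero_ext (@stably_zero_0 _ _ M M) => x; rewrite fK subrr.
by apply: stably_zero_ext (@stably_zero_0 _ _ N N) => x; rewrite gK subrr.
Qed.

Lemma stably_local_sum M k (f : 'I_k -> {linear M -> M}) : stably_local M ->
  stably_zero (fun x => \sum_i f i x - x) ->
  stably_zero (fun x : M => x) \/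
  exists i (w : {linear M -> M}), stably_zero (fun x => w (f i x) - x).
Proof.
move=> lM; elim: k f => [|k IH] f H.
  by left; apply: stably_zero_ext (stably_zeroN H) => x; rewrite big_ord0 sub0r opprK.
pose rest : {linear M -> M} := ffcotuple (fun i : 'I_k => idfun : {linear M -> M}) \o
  fftuple (fun i : 'I_k => f (lift ord0 i)).
have restE x : rest x = \sum_(i < k) f (lift ord0 i) x.
  by rewrite /rest /= /ffcotuple; apply: eq_bigr => i _; rewrite ffunE.
have H' : stably_zero (fun x => f ord0 x + rest x - x).
  by apply: stably_zero_ext H => x; rewrite big_ord_recl restE.
case: (lM (f ord0) rest H') => [[w wP]|[w wP]]; first by right; exists ord0, w.
have [|?|[i [w' wP']]] := IH (fun i => w \o f (lift ord0 i) : {linear M -> M}).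
- by apply: stably_zero_ext wP => x; rewrite restE linear_sum.
- by left.
by right; exists (lift ord0 i), (w' \o w : {linear M -> M}).
Qed.

(** The identity of M is the sum of its components through the k copies of X. By locality one
    component M -> X has a stable left inverse, so [no_proj_inj] makes it injective. *)
Lemma stably_local_kdim M X k (s : {linear M -> ffunm k X}) (r : {linear ffunm k X -> M}) :
  (forall x, r (s x) = x) -> stably_local M -> no_proj_summand M ->
  (kdim M <= kdim X)%N.
Proof.
move=> rs lM np.
pose sl l : {linear M -> X} := @ffproj _ _ k X l \o s.
pose rl l : {linear X -> M} := r \o @ffin _ _ k X l.
have [||[i [w wP]]] := @stably_local_sum M k (fun l => rl l \o sl l : {linear M -> M}) lM.
- apply: stably_zero_ext (@stably_zero_0 _ _ M M) => x.
  by rewrite -{2}[x]rs {1}(ffin_sum (s x)) linear_sum subrr.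
- by move=> /(no_proj_zero np) M0; rewrite kdim_zero.
apply: (@kdim_inj _ _ _ _ (sl i)).
exact: (@no_proj_inj _ _ (sl i) (w \o rl i : {linear X -> M})).
Qed.

Definition indecomposable M : Prop :=
  forall N (s : {linear N -> M}) (r : {linear M -> N}), (forall x, r (s x) = x) ->
    (forall x : N, x = 0) \/ (forall x, s (r x) = x).

Lemma indec_fitting M (f : {linear M -> M}) : indecomposable M ->
  (exists n, forall x, iter n f x = 0) \/ bijective f.
Proof.
move=> ind; have [n [I [q [i [g' [qS iI iq gK]]]]]] := fitting f.
have [I0|e] := ind I i (g' \o q : {linear M -> I}) gK.
  by left; exists n.+1 => x; rewrite -iq (I0 (q x)) linear0.
right; have fI : injective f.
  apply: lin_eq0_inj => x fx; rewrite -[x]e /=.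
  have -> : q x = 0; last by rewrite !linear0.
  by apply: iI; rewrite iq linear0 iterSr fx -lin_iterE linear0.
exact: inj_surj_bij fI (kdim_inj_bij fI (leqnn _)).
Qed.

Lemma nilp_sub_bij M (f : {linear M -> M}) n : (forall x, iter n f x = 0) ->
  bijective (idfun \- f : {linear M -> M}).
Proof.
move=> fn; have I : injective (idfun \- f : {linear M -> M}).
  apply: lin_eq0_inj => x /= /eqP; rewrite subr_eq0 => /eqP e.
  have it m : iter m f x = x by elim: m => //= m ->; rewrite -e.
  by rewrite -(it n) fn.
exact: inj_surj_bij I (kdim_inj_bij I (leqnn _)).
Qed.

(** Either f is invertible, or it is nilpotent and 1 - f is invertible; stably, g is 1 - f. *)
Lemma indec_stably_local M : indecomposable M -> stably_local M.
Proof.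
move=> ind f g fg.
have left0 (h w : {linear M -> M}) : (forall x, w (h x) = x) -> stably_zero (fun x => w (h x) - x).
  by move=> e; apply: stably_zero_ext (@stably_zero_0 _ _ M M) => x; rewrite e subrr.
have inv (h : {linear M -> M}) : bijective h -> exists w : {linear M -> M}, forall x, w (h x) = x.
  by move=> /lin_inv[w [hK _]]; exists w.
have [[n fn]|fb] := indec_fitting f ind; last first.
  by left; have [w wP] := inv f fb; exists w; exact: left0.
right.
have [v vP] := inv _ (nilp_sub_bij fn).
exists v; apply: stably_zero_ext (stably_zero_compl v fg) => x.
have -> : f x + g x - x = g x - (idfun \- f : {linear M -> M}) x.
  by rewrite /= opprB addrA [g x + _]addrC.
by rewrite linearB vP.
Qed.

Hypothesis hA : selfinjective A.

(** Stable endomorphisms of Z and N correspond under Omega, so the relation f + g = 1 moves to N and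
    the left inverse moves back. *)
Lemma stably_local_syz Z P N (i : {linear Z -> P}) (p : {linear P -> N}) :
  ses i p -> projective_mod P -> stably_local N -> stably_local Z.
Proof.
move=> ip pP lN f g fg.
have [b [c [ab bc]]] := ladder_l hA ip ip pP f.
have [b' [c' [ab' bc']]] := ladder_l hA ip ip pP g.
have H : stably_zero (((c \+ c') \- idfun) : {linear N -> N}).
  apply/(ladder_stably_zero hA ip ip pP pP (a := (f \+ g) \- idfun : {linear Z -> Z})
     (b := (b \+ b') \- idfun : {linear P -> P})) => //= x.
    by rewrite linearB linearD ab ab'.
  by rewrite linearB linearD bc bc'.
have tr (h : {linear Z -> Z}) (d : {linear P -> P}) (e : {linear N -> N}) :
    (forall x, d (i x) = i (h x)) -> (forall x, e (p x) = p (d x)) ->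
    (exists w : {linear N -> N}, stably_zero (fun x => w (e x) - x)) ->
    exists w : {linear Z -> Z}, stably_zero (fun x => w (h x) - x).
  move=> hd de [w wP]; have [w' [d' [hd' de']]] := ladder_r ip ip pP w.
  exists w'; apply/(ladder_stably_zero hA ip ip pP pP (a := (w' \o h) \- idfun : {linear Z -> Z})
     (b := (d' \o d) \- idfun : {linear P -> P})
     (c := (w \o e) \- idfun : {linear N -> N})) => //= x.
    by rewrite linearB hd hd'.
  by rewrite linearB de de'.
have [h|h] := lN c c' H; [left; exact: tr ab bc h | right; exact: tr ab' bc' h].
Qed.

Lemma stably_local_syzygy i M : stably_local M -> stably_local (syzygy i M).
Proof.
elim: i => // i IH lM; have [j [p jp]] := free_syz_ses (syzygy i M).
exact: stably_local_syz jp (@free_projective _ _ _) (IH lM).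
Qed.

Lemma stably_zero_Gmap M N (f : {linear M -> N}) : stably_zero f -> stably_zero (Gmap f).
Proof.
move=> [P [u [v [pP fE]]]]; exists (Gmod P), (Gmap u), (Gmap v); split.
  exact: G_projective.
by move=> x; apply: homT_ext => t; rewrite !GmapE fE.
Qed.

Lemma stably_local_G Y : stably_local (Gmod Y) -> stably_local Y.
Proof.
move=> lG f g fg.
have H : stably_zero (fun x => Gmap f x + Gmap g x - x).
  have := stably_zero_Gmap (f := (f \+ g) \- idfun : {linear Y -> Y}) fg.
  by apply: stably_zero_ext => x; apply: homT_ext.
have tr (h : {linear Y -> Y}) :
    (exists w : {linear Gmod Y -> Gmod Y}, stably_zero (fun x => w (Gmap h x) - x)) ->
    exists w : {linear Y -> Y}, stably_zero (fun x => w (h x) - x).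
  move=> [w wP]; have [w' w'E] := G_full hA w; exists w'.
  apply: (@G_reflect_stably_zero _ _ hA _ _ ((w' \o h) \- idfun : {linear Y -> Y})).
  by apply: stably_zero_ext wP => x; rewrite -w'E; apply: homT_ext.
have [e|e] := lG (Gmap f) (Gmap g) H; [left | right]; exact: tr.
Qed.

End Local.

(** * Bounded resolutions *)

Section Bound.
Variables (K : fieldType) (A : falgType K).
Implicit Types M N X Y Z P Q E W U V : fgmod A.
Hypothesis hA : selfinjective A.

Lemma stable_hom0_retract_r M N N' (s : {linear N' -> N}) (r : {linear N -> N'}) :
  (forall x, r (s x) = x) -> stable_hom0 M N -> stable_hom0 M N'.
Proof.
move=> rs H f; apply: stably_zero_ext (stably_zero_compl r (H (s \o f : {linear M -> N}))) => x.
by rewrite /= rs.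
Qed.

Lemma stable_hom0_ffun M k X : stable_hom0 M X -> stable_hom0 M (ffunm k X).
Proof.
move=> H f.
have h := @stably_zero_sum _ _ M (ffunm k X) k (fun l x => ffin l (f x l))
  (fun l => stably_zero_compl (@ffin _ _ k X l) (H (@ffproj _ _ k X l \o f : {linear M -> X}))).
by apply: stably_zero_ext h => x; rewrite -ffin_sum.
Qed.

Lemma stable_hom0_syzygy i j M N :
  stable_hom0 (syzygy i M) N -> stable_hom0 (syzygy (i + j) M) (syzygy j N).
Proof.
move=> H; elim: j => [|j IH]; first by rewrite addn0.
rewrite addnS.
have [i1 [p1 s1]] := free_syz_ses (syzygy (i + j) M).
have [i2 [p2 s2]] := free_syz_ses (syzygy j N).
exact: (stable_hom0_syz hA s1 s2 (@free_projective _ _ _) (@free_projective _ _ _) IH).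
Qed.

(** Prepends the q free terms that lead from Omega^q Y back to Y. *)
Lemma part_res_syzygy C m q Y : part_res C C m (syzygy q Y) ->
  (forall i, (i < q)%N -> len_le C (freem A (kdim (syzygy i Y)))) -> part_res C C m Y.
Proof.
elim: q => // q IH H le; apply: IH => [|i iq]; last by apply: le; exact: ltnW.
apply: part_res_down; have [i [p ip]] := free_syz_ses (syzygy q Y).
by exists (free_syz (syzygy q Y)), (freem A (kdim (syzygy q Y))), i, p; split => //;
  [exact: free_projective | exact: le].
Qed.

(** Exponential in i, but applied only for i <= n + 2. *)
Lemma kdim_syzygy i M : (kdim (syzygy i M) <= kdim M * (kdim (regmod A)).+1 ^ i)%N.
Proof.
elim: i => [|i IH]; first by rewrite expn0 muln1.
apply: leq_trans (kdim_free_syz _) _; rewrite expnSr mulnA.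
by apply: leq_mul => //; exact: leqnSn.
Qed.

(** * The loop inside add X *)

Section MaximalOrthogonal.
Variables (n : nat) (X : fgmod A).
Hypothesis hX : maximal_orthogonal n X.

Lemma in_add_stable_hom0l M :
  in_add X M <-> forall i, (1 <= i <= n)%N -> stable_hom0 (syzygy i M) X.
Proof.
rewrite -(hX M).1; split => H [//|i] hi; have := H i.+1 hi; first by rewrite Ext_stable_hom0.
by move=> ?; apply/Ext_stable_hom0.
Qed.

Lemma in_add_stable_hom0r M :
  in_add X M <-> forall i, (1 <= i <= n)%N -> stable_hom0 (syzygy i X) M.
Proof.
rewrite -(hX M).2; split => H [//|i] hi; have := H i.+1 hi; first by rewrite Ext_stable_hom0.
by move=> ?; apply/Ext_stable_hom0.
Qed.

Lemma in_add_retract M : in_add X M -> exists k (s : {linear M -> ffunm k X})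
  (r : {linear ffunm k X -> M}), forall x, r (s x) = x.
Proof.
move=> [k [N [f fB]]].
pose f' : {linear prodm M N -> ffunm k X} := f.
have [g [fK _]] := @lin_inv _ _ (prodm M N) (ffunm k X) f' fB.
have [i [p [_ [iE _]]]] := ses_prod M N.
have L : linear (fun z : prodm M N => z.1) by [].
exists k, (f' \o i : {linear M -> ffunm k X}), (mklin L \o g : {linear ffunm k X -> M}).
by move=> x; rewrite /= fK iE.
Qed.

Lemma retract_in_add M N (s : {linear N -> M}) (r : {linear M -> N}) :
  (forall x, r (s x) = x) -> in_add X M -> in_add X N.
Proof.
move=> rs /in_add_stable_hom0r H; apply/in_add_stable_hom0r => i hi.
exact: stable_hom0_retract_r rs (H i hi).
Qed.

(* Y1 is nu Omega^(n+2) Y, described by G Y1 = Omega^(n+2) Y. *)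
Lemma in_add_nakayama Y : in_add X Y -> exists Y1 : fgmod A,
  [/\ in_add X Y1, (kdim Y1 <= kdim (syzygy n.+1 Y) * kdim (dualm A))%N &
    exists theta : {linear syzygy n.+2 Y -> Gmod Y1}, bijective theta].
Proof.
move=> /in_add_stable_hom0l hY.
have [i [p ip]] := free_syz_ses (syzygy n.+1 Y); have [iI _ _] := ip.
have [Y1 [dY1 th serre]] := nakayama_exists hA iI.
exists Y1; split => //; apply/in_add_stable_hom0r => j /andP[j1 jn].
apply: (serre _ p ip).
(* Both j and n+1-j lie between 1 and n, so the vanishing known for Y applies at n+1-j. *)
have -> : n.+1 = (n.+1 - j + j)%N by rewrite subnK // ltnW.
apply: stable_hom0_syzygy; apply: hY.
by rewrite subn_gt0 ltnS jn /= leq_subLR -add1n leq_add2r.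
Qed.

(** The constant depends on [d] only, neither on [Y] nor on [m]: every turn of the loop comes back
    to a module of dimension at most [d]. *)
Lemma bound_stably_local d : (kdim X <= d)%N -> exists C, forall m Y,
  in_add X Y -> stably_local Y -> (kdim Y <= d)%N -> part_res C C m Y.
Proof.
move=> dX; pose e := kdim (regmod A); pose t := kdim (dualm A).
(* [B] bounds the dimensions of Omega^i Y for i <= n + 2, [a] those of their free covers, and
   [B * t] that of [Y1]. *)
pose B := (d * e.+1 ^ n.+2)%N.
pose a := (B * e)%N; pose C := (a + B * t)%N.
have dim_syz i Y : (kdim Y <= d)%N -> (i <= n.+2)%N -> (kdim (syzygy i Y) <= B)%N.
  move=> dY hi; apply: leq_trans (kdim_syzygy i Y) _; apply: leq_mul => //.
  exact: leq_pexp2l.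
have cov i Y : (kdim Y <= d)%N -> (i <= n.+2)%N -> len_le a (freem A (kdim (syzygy i Y))).
  move=> dY hi; apply: len_le_kdim; rewrite kdim_ffun; apply: leq_mul => //.
  exact: dim_syz.
have aC : (a <= C)%N by exact: leq_addr.
have main : forall m Y, in_add X Y -> stably_local Y -> (kdim Y <= d)%N -> part_res a C m Y.
  elim=> // m IH Y aY lY dY.
  have [Y1 [aY1 dY1 [th thB]]] := in_add_nakayama aY.
  have lY1 : stably_local Y1.
    apply: (stably_local_G hA); apply: stably_local_stably_iso (stably_iso_bij thB) _.
    exact: stably_local_syzygy.
  have [Y' [s [r [rs sr np]]]] := no_proj_retract Y1.
  have aY' := retract_in_add rs aY1.
  have lY' : stably_local Y'.
    apply: stably_local_stably_iso lY1; exists r, s; split => //.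
    by apply: stably_zero_ext (@stably_zero_0 _ _ Y' Y') => x; rewrite rs subrr.
  (* [Y'] is no larger than X, so the induction hypothesis applies to it with the same constants. *)
  have dY' : (kdim Y' <= d)%N.
    have [k [s' [r' rs']]] := in_add_retract aY'.
    exact: leq_trans (stably_local_kdim rs' lY' np) dX.
  have [Q [i [q [iS qi iq]]]] := ker_ses_split rs; have [iI _ _] := iS.
  (* The idempotent i q = 1 - s r is stably zero, hence so is the identity of Q. *)
  have pQ : projective_mod Q.
    apply: stably_zero_id_proj.
    have iqsr := stably_zeroN (stably_zero_compr i (stably_zero_compl q sr)).
    apply: stably_zero_ext iqsr => x.
    have h y : q (s y) = 0 by apply: iI; rewrite iq rs subrr linear0.
    by rewrite linearB h sub0r opprK qi.
  have lQ : len_le (B * t) Q.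
    apply: len_le_kdim; apply: leq_trans (kdim_inj iI) (leq_trans dY1 _).
    by apply: leq_mul => //; exact: dim_syz.
  (* Only the first term grows, from [a] to [a + B * t], which is [C]. *)
  have R1 : part_res C C m Y1 := part_res_retract rs iS pQ lQ (IH _ aY' lY' dY').
  have RW : part_res C C m (syzygy n.+2 Y).
    have [th' [thK th'K]] := lin_inv thB.
    exact: (part_res_iso (Bijective th'K thK) (part_res_G hA R1)).
  have R2 : part_res C C m (syzygy 1 Y).
    apply: (@part_res_syzygy C m n.+1 (syzygy 1 Y)).
      by rewrite /syzygy -iterD addn1.
    move=> l hl; rewrite -[syzygy l (syzygy 1 Y)]iterD addn1.
    by apply: len_le_mono aC _; exact: (cov l.+1 Y dY (leqW hl)).
  have [i0 [p0 ip0]] := free_syz_ses Y.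
  exists (free_syz Y), (freem A (kdim Y)), i0, p0; split => //.
    exact: free_projective.
  exact: (cov 0%N).
by exists C => m Y aY lY dY; apply: part_res_mono (main m Y aY lY dY).
Qed.

(** An indecomposable module is stably local. Otherwise M splits into two smaller modules of add X,
    whose bounds add up. *)
Lemma bound_in_add M : in_add X M -> exists C, forall m, part_res C C m M.
Proof.
have [d] := ubnP (kdim M); elim: d M => // d IH M; rewrite ltnS => dM aM.
have [ind|] := pselect (indecomposable M).
  have [C CP] := @bound_stably_local (maxn (kdim M) (kdim X)) (leq_maxr _ _).
  by exists C => m; apply: CP => //; [exact: indec_stably_local | exact: leq_maxl].
move=> nind.
have [N [s [r [rs N0 sr]]]] : exists N (s : {linear N -> M}) (r : {linear M -> N}),
    [/\ forall x, r (s x) = x, ~ (forall x : N, x = 0) & ~ (forall x, s (r x) = x)].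
  apply: contrapT => H; apply: nind => N s r rs.
  have [N0|N0] := pselect (forall x : N, x = 0); first by left.
  right; apply: contrapT => sr; apply: H; by exists N, s, r.
have [Q [i [q [iS qi iq]]]] := ker_ses_split rs; have [iI _ _] := iS.
have sI : injective s by exact: can_inj rs.
have lt1 : (kdim N < kdim M)%N.
  rewrite ltnNge; apply/negP => /(kdim_inj_bij sI) S; apply: sr => x.
  by have [y <-] := S x; rewrite rs.
have lt2 : (kdim Q < kdim M)%N.
  rewrite ltnNge; apply/negP => /(kdim_inj_bij iI) S; apply: N0 => x.
  by have [y yE] := S (s x); rewrite -(rs x) -yE (ses_comp0 _ iS).
have [C CP] := IH N (leq_trans lt1 dM) (retract_in_add rs aM).
have [D DP] := IH Q (leq_trans lt2 dM) (retract_in_add qi aM).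
by exists (D + C)%N => m; exact: part_res_ext iS (DP m) (CP m).
Qed.

(** * Approximation of arbitrary modules by add X *)

Lemma hom_finite N M : exists h (u : 'I_h -> {linear N -> M}), forall f : {linear N -> M},
  exists c : 'I_h -> K, forall x, f x = \sum_l u l (kmul (c l) x).
Proof.
have [||S SP] := @vspace_of_pred K 'Hom(kvec N, kvec M)
   (fun f => exists g : {linear N -> M}, forall x : N, f x = g x).
- by exists (\0 : {linear N -> M}) => x; rewrite zero_lfunE.
- move=> a f g [f' fE] [g' gE].
  exists ((@kmul _ _ M a \o f') \+ g' : {linear N -> M}) => x.
  by rewrite add_lfunE scale_lfunE fE gE.
have uP (l : 'I_(\dim S)) : exists g : {linear N -> M}, forall x : N, (vbasis S)`_l x = g x.
  by apply/SP/vbasis_mem/mem_nth; rewrite size_tuple.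
have [u uE] := choice uP.
exists (\dim S), u => f.
have fS : linfun (klin f) \in S by apply/SP; exists f => x; rewrite lfunE.
exists (fun l => coord (vbasis S) l (linfun (klin f))) => x.
have -> : f x = linfun (klin f) x by rewrite lfunE.
rewrite {1}(coord_vbasis fS) sum_lfunE; apply: eq_bigr => l _.
by rewrite scale_lfunE uE kscaleE /kmul linearZ.
Qed.

Lemma in_add_proj P : projective_mod P -> in_add X P.
Proof.
move=> pP; apply/in_add_stable_hom0r => i _ f.
by exists P, f, idfun.
Qed.

(** The map is assembled from a [K]-basis of Hom(X, M), so every map from X factors through it. It
    is onto because A lies in add X. *)
Lemma approximation M : exists h (eps : {linear ffunm h X -> M}),
  surjective_lin eps /\
  forall f : {linear X -> M}, exists f' : {linear X -> ffunm h X}, forall x, eps (f' x) = f x.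
Proof.
have [h [u uP]] := hom_finite X M.
exists h, (ffcotuple u).
have lift (f : {linear X -> M}) : exists f' : {linear X -> ffunm h X},
    forall x, ffcotuple u (f' x) = f x.
  have [c cP] := uP f; exists (fftuple (fun l => @kmul _ _ X (c l) : {linear X -> X})).
  by move=> x; rewrite cP; apply: eq_bigr => l _; rewrite ffunE.
split=> // y.
have [k [s [r rs]]] := in_add_retract (in_add_proj (@free_projective _ A 1)).
have [f' fE] := choice (fun l : 'I_k =>
  lift (comb (fun _ : 'I_1 => y) \o (r \o @ffin _ _ k X l) : {linear X -> M})).
exists (\sum_l f' l (s (freeb A ord0) l)).
rewrite linear_sum -[RHS](comb_freeb (fun _ : 'I_1 => y) ord0) -[in RHS](rs (freeb A ord0)).
rewrite [in RHS](ffin_sum (s _)) !linear_sum; apply: eq_bigr => l _.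
exact: (fE l (s (freeb A ord0) l)).
Qed.

Lemma bound_all M : exists C, forall m, part_res C C m M.
Proof.
(* Here t counts the vanishing conditions still missing for M to lie in add X; passing to the kernel
   of an approximation gains one. *)
have claim : forall t j, (j + t = n)%N -> forall M,
    (forall i, (1 <= i <= j)%N -> stable_hom0 (syzygy i X) M) ->
    exists C, forall m, part_res C C m M.
  elim=> [|t IH] j; first by rewrite addn0 => -> N /in_add_stable_hom0r; exact: bound_in_add.
  rewrite addnS -addSn => e N H.
  have [h [eps [epsS epsL]]] := approximation N.
  have [M1 [i iS]] := ses_ker epsS; have [iI _ ker] := iS.
  have aX0 : in_add X (ffunm h X).
    have aX : in_add X X.
      exists 1%N, (ffunm 0 X).
      pose f (z : (X * ffunm 0 X)%type) : {ffun 'I_1 -> X} := [ffun _ => z.1].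
      have fL : linear f by move=> a x y; apply/ffunP => l; rewrite !ffunE.
      exists (mklin fL); exists (fun g : {ffun 'I_1 -> X} => (g ord0, 0)).
        by move=> [x y] /=; rewrite ffunE; congr (_, _); apply/ffunP => -[].
      by move=> g; apply/ffunP => l; rewrite /= ffunE (ord1 l).
    by apply/in_add_stable_hom0r => k hk; apply: stable_hom0_ffun; exact: (in_add_stable_hom0r X).1.
  have [C CP] : exists C, forall m, part_res C C m M1.
    apply: (IH j.+1 e) => -[//|k] /andP[_ kj] f.
    (* For k = 0 this is the approximation property; for k > 0 the map c is stably zero by
       hypothesis. *)
    have lift (c : {linear syzygy k X -> N}) :
        exists c' : {linear syzygy k X -> ffunm h X}, forall x, eps (c' x) = c x.
      case: k kj c {f} => [_ c|k kj c]; first exact: epsL.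
      by apply: stably_zero_lift => //; apply: H.
    have [i0 [p0 ip0]] := free_syz_ses (syzygy k X); have [i0I p0S ker0] := ip0.
    have X0k : stable_hom0 (syzygy k.+1 X) (ffunm h X).
      apply: (in_add_stable_hom0r _).1 => //; rewrite /= -e.
      by apply: leq_trans kj _; exact: leq_addr.
    (* [f], viewed in X^h, extends to [b] on the free cover of Omega^k X, and [b] induces [c] on
       Omega^k X. Subtracting a lift of [c] moves [b] into M1, so that [f] factors through a free
       module. *)
    have [b bE] := stably_zero_extend hA i0I (X0k (i \o f : {linear syzygy k.+1 X -> ffunm h X})).
    have [|c cE] := @lin_fact_surj _ _ _ _ _ p0 (eps \o b : {linear freem A _ -> N}) p0S.
      by move=> x /ker0[z <-]; rewrite /= bE /= (ses_comp0 _ iS).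
    have [c' c'E] := lift c.
    have [|g gE] := @lin_fact_inj _ _ _ _ _ i
        (b \- (c' \o p0) : {linear freem A _ -> ffunm h X}) iI.
      by move=> x; apply/ker; rewrite /= linearB c'E cE subrr.
    exists (freem A (kdim (syzygy k X))), i0, g; split; first exact: free_projective.
    move=> x; apply: iI; rewrite gE /= bE /= (ses_comp0 _ ip0) linear0 subr0 //.
  have [D DP] := bound_in_add aX0.
  exists (C + D)%N => -[//|m]; exact: part_res_quot iS (CP m) (DP m.+1).
by apply: (claim n 0%N) => // -[|i] //; rewrite andbF.
Qed.

End MaximalOrthogonal.
End Bound.

(** * Minimal resolutions *)

Section MinimalResolution.
Variables (K : fieldType) (A : falgType K).
Implicit Types M N X Y Z P Q E W U V : fgmod A.

Definition min_cover M (c : proj_cover M) : Prop :=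
  forall P (p : {linear P -> M}), projective_mod P -> surjective_lin p ->
    (kdim (cov_P c) <= kdim P)%N.

(** The Fitting image of f is a summand of the cover that still maps onto M; by minimality it is
    everything. *)
Lemma min_cover_endo M (c : proj_cover M) (f : {linear cov_P c -> cov_P c}) :
  min_cover c -> (forall x, cov_p c (f x) = cov_p c x) -> bijective f.
Proof.
move=> minc pf; have [_ pS _] := cov_ses c.
have [n [I [q [i [g' [qS iI iq gK]]]]]] := fitting f.
have pI : projective_mod I.
  exact: (retract_projective (s := i) (r := g' \o q : {linear _ -> _}) gK (cov_proj c)).
have piS : surjective_lin (cov_p c \o i : {linear I -> M}).
  move=> y; have [x <-] := pS y; exists (q x); rewrite /= iq.
  by elim: n.+1 => //= k IH; rewrite pf.
have iS := kdim_inj_bij iI (minc _ _ pI piS).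
have fS : surjective_lin f.
  move=> x; have [z <-] := iS x; have [w <-] := qS z.
  by exists (iter n f w); rewrite iq.
exact: inj_surj_bij (kdim_surj_bij fS (leqnn _)) fS.
Qed.

(** If U and the kernel span the cover, U maps onto M. A lift of the cover into U is then an
    endomorphism over M, bijective by [min_cover_endo]. *)
Lemma min_cover_superfluous M (c : proj_cover M) : min_cover c -> superfluous_ker (cov_p c).
Proof.
move=> minc U [U0 Ul] Usum; have [_ pS _] := cov_ses c.
have [||N [i [iI iU]]] := @submod_of_pred _ _ (cov_P c) (fun x => x \in U).
- exact: U0.
- by move=> a u v; exact: Ul.
have piS : surjective_lin (cov_p c \o i : {linear N -> M}).
  move=> y; have [x <-] := pS y; have [u [v [uU v0 ->]]] := Usum x.
  by have [z zE] := (iU u).1 uU; exists z; rewrite /= zE linearD v0 addr0.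
have [g gE] := cov_proj c _ _ _ (cov_p c) piS.
have [f' fK f'K] := min_cover_endo (f := i \o g : {linear _ -> _}) minc gE.
by move=> x; apply/iU; exists (g (f' x)); exact: f'K.
Qed.

Lemma min_cover_exists M : exists c : proj_cover M, min_cover c.
Proof.
pose S d := `[< exists P (p : {linear P -> M}),
  [/\ projective_mod P, surjective_lin p & kdim P = d] >].
have exS : exists d, S d.
  have [p pS] := free_cover M; exists (kdim (freem A (kdim M))); apply/asboolP.
  by exists (freem A (kdim M)), p; split => //; exact: free_projective.
case: (ex_minnP exS) => d /asboolP[P [p [pP pS dP]]] dmin.
have [Z [i ip]] := ses_ker pS.
exists (ProjCover ip pP) => Q q pQ qS /=; rewrite dP; apply: dmin; apply/asboolP.
by exists Q, q.
Qed.

(** Stated for a retract N of M because the induction needs it: the kernel of the minimal cover of N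
    is a retract of the kernel of any cover of M. *)
Lemma min_res_bound (c : forall M, proj_cover M) (C : nat) :
  (forall M, min_cover (c M)) ->
  forall m M N (s : {linear N -> M}) (r : {linear M -> N}),
    (forall x, r (s x) = x) -> part_res C C m M ->
    forall i, (i < m)%N -> (kdim (cov_mod c N i) <= C * kdim (regmod A))%N.
Proof.
move=> cmin; elim=> // m IH M N s r rs [Z [Q [l [t [lt pQ lQ rZ]]]]].
have [lI tS _] := lt; have [iI pS ker] := cov_ses (c N).
have rtS : surjective_lin (r \o t : {linear Q -> N}).
  by move=> y; have [x xE] := tS (s y); exists x; rewrite /= xE rs.
case=> [_|i im]; first exact: leq_trans (cmin N _ _ pQ rtS) (kdim_len_le lQ).
rewrite /cov_mod /cov_syz iterSr -/(cov_syz c (cov_Z (c N)) i).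
have [a aE] := cov_proj (c N) _ _ _ (s \o cov_p (c N) : {linear _ -> _}) tS.
have [b bE] := pQ _ _ _ (r \o t : {linear Q -> N}) pS.
have pba x : cov_p (c N) (b (a x)) = cov_p (c N) x by rewrite bE /= aE /= rs.
(* b a is an endomorphism of the minimal cover over N; its inverse [th] corrects b into a retraction
   of a, which then restricts to the kernels. *)
have [th [thK thK']] := lin_inv (min_cover_endo (f := b \o a : {linear _ -> _}) (cmin N) pba).
have pth x : cov_p (c N) (th x) = cov_p (c N) x by rewrite -[in RHS](thK' x) pba.
have [|a' a'E] := @lin_fact_inj _ _ _ _ _ l (a \o cov_i (c N) : {linear _ -> Q}) lI.
  have [_ _ tker] := lt; move=> z; apply/tker.
  by rewrite /= aE /= (ses_comp0 _ (cov_ses (c N))) linear0.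
have [|b' b'E] := @lin_fact_inj _ _ _ _ _ (cov_i (c N)) (th \o (b \o l) : {linear Z -> _}) iI.
  by move=> z; apply/ker; rewrite /= pth bE /= (ses_comp0 _ lt) linear0.
apply: (IH Z (cov_Z (c N)) a' b') => // z; apply: iI.
by rewrite b'E /= a'E; exact: thK.
Qed.

End MinimalResolution.

Theorem theorem1p1 (R : realType) (K : fieldType) (A : falgType K)
    (hA : selfinjective A) (n : nat) (hn : (1 <= n)%N)
    (hX : exists X : fgmod A, maximal_orthogonal n X) (M : fgmod A) :
  (cx R M <= 1%:E)%E.
Proof.
have [X Xmax] := hX; have [C CP] := bound_all hA Xmax M.
have [c cmin] : exists c : forall N : fgmod A, proj_cover N, forall N, min_cover (c N).
  by exists (fun N => sval (cid (min_cover_exists N))) => N; exact: svalP.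
pose D := (C * kdim (regmod A))%N.
have dim_le m : (dimK (cov_mod c M m) <= D)%N.
  rewrite dimKE; exact: (min_res_bound cmin (s := idfun) (r := idfun) _ (CP m.+1)).
apply: ereal_inf_lbound; exists 1%N => //.
(* With b = 1 the exponent is zero, so a constant bound suffices; [D.+1] keeps it positive. *)
exists (res_of_cover c M), (D.+1%:R); split.
- split; first exact: min_cover_superfluous.
  move=> i U Uc Usum; apply: (min_cover_superfluous (cmin _) Uc) => x.
  have [u [v [uU v0 xE]]] := Usum x; exists u, v; split => //.
  by have [iI _ _] := cov_ses (c (cov_syz c M i)); apply: iI; rewrite linear0.
- by rewrite ltr0n.
- by move=> m _; rewrite subrr expr0z mulr1 ler_nat; apply: leq_trans (dim_le m) (leqnSn _).
Qed.
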